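(* Let $\sigma\in\mathbb{R}$ (positive, negative or zero). Any solitary wave with surface tension coefficient $\sigma$ and with $\sup u<c$, given in height-function form by $(h,H)$ and satisfying, for some $0<\alpha<1$ and $r=2/(1-\alpha)$, the regularity $$\eta=h(\cdot,0)-H(0)\in W^{2,r}_{\mathrm{loc}}(\mathbb{R}),\qquad h\in W^{2,r}_{\mathrm{loc}}(\overline\Omega)\subset C^{1+\alpha}_{\mathrm{loc}}(\overline\Omega),\qquad H\in W^{2,r}[-m,0],$$ satisfies $$\Big(\frac1{F^2}-1\Big)\int_{-M}^M\eta\,dx+\int_{-M}^M\int_{-m}^0\frac{H_p^3h_q^2+(2h_p+H_p)(h_p-H_p)^2}{2h_p^2}\,dp\,dq\to0\qquad\text{as }M\to\infty .$$
   Context: Fix $g>0$, $d>0$, $c>0$, and a flux $m>0$. Let $\Omega=\{(q,p):-m<p<0\}$. Physically, a solitary wave with surface tension is a solution of the steady incompressible Euler equations $(u-c)u_x+vu_y=-P_x$, $(u-c)v_x+vv_y=-P_y-g$, $u_x+v_y=0$ in $-d<y<\eta(x)$, with $v=0$ on $y=-d$, $v=(u-c)\eta_x$ and $P+\sigma\big(\eta_x/\sqrt{1+\eta_x^2}\big)_x=0$ on $y=\eta(x)$, and $\eta\to0$, $v\to0$, $u\to U(y)$ as $x\to\pm\infty$ uniformly in $y$. When $\sup u<c$, let $\psi$ be the stream function ($\psi_y=u-c$, $\psi_x=-v$, $\psi=0$ on $y=\eta$, $\psi=m$ on $y=-d$), and use the variables $q=x$, $p=-\psi$. The height function $h(q,p)$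 is defined by $h(x,-\psi(x,y))=y+d$, and the asymptotic height function $H$ by $H(-\Psi(y))=y+d$, where $\Psi(y)=\int_0^y(U(s)-c)\,ds$. Thus $H(-m)=0$, $H(0)=d$. In height-function form (the form used here), a solitary wave with $\sup u<c$ is a pair $(h,H)$ with $\inf h_p>0$, $\min H_p>0$, $H(-m)=0$, $H(0)=d$, satisfying $$\Big(-\frac{1+h_q^2}{2h_p^2}+\frac1{2H_p^2}\Big)_p+\Big(\frac{h_q}{h_p}\Big)_q=0\quad\text{in }-m<p<0,$$ $$\frac{1+h_q^2}{2h_p^2}-\frac1{2H_p^2}+g(h-H)-\sigma\Big(\frac{h_q}{(1+h_q^2)^{1/2}}\Big)_q=0\quad\text{on }p=0,$$ $h=0$ on $p=-m$, and $h_p\to H_p$, $h_q\to0$ as $q\to\pm\infty$ uniformly in $p$. The velocity and surface are recovered by $c-u=1/h_p$, $v=-h_q/h_p$, $\eta(q)=h(q,0)-H(0)$, with $c-U(H(p)-d)=1/H_p(p)$. The Froude number $F>0$ is defined by $\displaystyle\frac1{F^2}=g\int_{-d}^0\frac{dy}{(c-U(y))^2}=g\int_{-m}^0H_p^3\,dp$. *)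

(* Defs.v *)
From mathcomp Require Import all_boot all_order all_algebra.
From mathcomp Require Import all_classical all_reals all_analysis.

Set Implicit Arguments.
Unset Strict Implicit.
Unset Printing Implicit Defensive.

Import Order.TTheory GRing.Theory Num.Theory.
Import numFieldNormedType.Exports.

Local Open Scope classical_set_scope.
Local Open Scope ring_scope.

(* Points of the plane are pairs z = (q, p); [e_q] and [e_p] are the two
   coordinate directions. *)
Definition e_q (R : realType) : R * R := (1, 0).
Definition e_p (R : realType) : R * R := (0, 1).
Arguments e_q {R}.
Arguments e_p {R}.

Notation leb2 := (lebesgue_measure \x lebesgue_measure)%E.

Definition compactly_supported (R : realType) (T : topologicalType)
    (D : set T) (phi : T -> R) : Prop :=
  exists K : set T, [/\ compact K, K `<=` D & forall x, ~ K x -> phi x = 0].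

Definition test1 (R : realType) (D : set R) (phi : R -> R) : Prop :=
  (forall (n : nat) (x : R), derivable (phi^`(n)%classic) x 1) /\
  compactly_supported D phi.

(* Iterated partial derivatives of phi: [true] stands for d/dq, [false] for
   d/dp. *)
Definition iter_partial (R : realType) (s : seq bool) (phi : R * R -> R) :
    R * R -> R :=
  foldr (fun (b : bool) f z => 'D_(if b then e_q else e_p) f z) phi s.

Definition test2 (R : realType) (D : set (R * R)) (phi : R * R -> R) : Prop :=
  (forall (s : seq bool) (z : R * R), differentiable (iter_partial s phi) z) /\
  compactly_supported D phi.

(* The value at the test function [phi] of the distribution f' (resp. d_v f)
   on [D]. *)
Definition dist_deriv (R : realType) (D : set R) (f phi : R -> R) : R :=
  - \int[lebesgue_measure]_(x in D) (f x * (phi^`())%classic x).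

Definition dist_partial (R : realType) (D : set (R * R)) (v : R * R)
    (f phi : R * R -> R) : R :=
  - \int[leb2]_(z in D) (f z * 'D_v phi z).

Definition weak_deriv (R : realType) (D : set R) (f f' : R -> R) : Prop :=
  forall phi, test1 D phi ->
    dist_deriv D f phi = \int[lebesgue_measure]_(x in D) (f' x * phi x).

Definition weak_partial (R : realType) (D : set (R * R)) (v : R * R)
    (f fv : R * R -> R) : Prop :=
  forall phi, test2 D phi ->
    dist_partial D v f phi = \int[leb2]_(z in D) (fv z * phi z).

(* W^{k,r}(D), as the functions of L^r(D) whose first weak derivatives exist and
   are in W^{k-1,r}(D). *)
Fixpoint sobolev1 (R : realType) (k : nat) (r : R) (D : set R) (f : R -> R) :
    Prop :=
  (f \_ D) \in Lfun lebesgue_measure r%:E /\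
  (if k is k'.+1 then
     exists2 f', weak_deriv D f f' & sobolev1 k' r D f'
   else True).

Fixpoint sobolev2 (R : realType) (k : nat) (r : R) (D : set (R * R))
    (f : R * R -> R) : Prop :=
  (f \_ D) \in Lfun (leb2) r%:E /\
  (if k is k'.+1 then
     (exists2 fq, weak_partial D e_q f fq & sobolev2 k' r D fq) /\
     (exists2 fp, weak_partial D e_p f fp & sobolev2 k' r D fp)
   else True).

Definition strip (R : realType) (m : R) : set (R * R) := setT `*` `]- m, 0[.
Definition cstrip (R : realType) (m : R) : set (R * R) := setT `*` `[- m, 0].

(* W^{k,r}_loc(R) *)
Definition sobolev_loc_line (R : realType) (k : nat) (r : R) (f : R -> R) :
    Prop :=
  forall M : R, 0 < M -> sobolev1 k r `]- M, M[ f.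

(* W^{k,r}_loc of the closed strip: local in q only, up to p = -m and p = 0. *)
Definition sobolev_loc_cstrip (R : realType) (m : R) (k : nat) (r : R)
    (f : R * R -> R) : Prop :=
  forall M : R, 0 < M -> sobolev2 k r (`]- M, M[ `*` `]- m, 0[) f.

Definition holder_loc_cstrip (R : realType) (m alpha : R) (f : R * R -> R) :
    Prop :=
  forall M : R, 0 < M -> exists C : R, forall z w : R * R,
    (`[- M, M] `*` `[- m, 0]) z -> (`[- M, M] `*` `[- m, 0]) w ->
    `|f z - f w| <= C * `|z - w| `^ alpha.

(* [f] is C^{1+alpha}_loc on the closed strip, with first partial derivatives
   [fq] and [fp]: on the boundary lines these are the continuous extensions of
   the partial derivatives in the open strip. *)
Definition C1holder_loc_cstrip (R : realType) (m alpha : R)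
    (f fq fp : R * R -> R) : Prop :=
  [/\ {within cstrip m, continuous f},
      forall z, strip m z -> is_derive z e_q f (fq z),
      forall z, strip m z -> is_derive z e_p f (fp z),
      holder_loc_cstrip m alpha fq &
      holder_loc_cstrip m alpha fp].

(* [f] is C^1 on [a, b] with derivative [f'] (by continuous extension at the
   endpoints). *)
Definition C1_itv (R : realType) (a b : R) (f f' : R -> R) : Prop :=
  [/\ {within `[a, b], continuous f},
      forall x, x \in `]a, b[ -> is_derive x 1 f (f' x) &
      {within `[a, b], continuous f'}].

(* [hq], [hp] and [Hp] are the derivatives of [h] and [H]; the two functions
   below are the fluxes of the divergence-form equation (flux_p)_p + (flux_q)_q = 0. *)
Definition flux_p (R : realType) (hq hp : R * R -> R) (Hp : R -> R)
    (z : R * R) : R :=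
  - ((1 + hq z ^+ 2) / (2 * hp z ^+ 2)) + 1 / (2 * Hp z.2 ^+ 2).

Definition flux_q (R : realType) (hq hp : R * R -> R) (z : R * R) : R :=
  hq z / hp z.

(* For h in W^{2,r}_loc, r > 2, the equation in the strip and the one on p = 0
   involve second derivatives that are only defined almost everywhere; both are
   required in the sense of distributions. *)
Definition interior_eq (R : realType) (m : R) (hq hp : R * R -> R)
    (Hp : R -> R) : Prop :=
  forall phi, test2 (strip m) phi ->
    dist_partial (strip m) e_p (flux_p hq hp Hp) phi +
    dist_partial (strip m) e_q (flux_q hq hp) phi = 0.

Definition surface_eq (R : realType) (g sigma : R) (h hq hp : R * R -> R)
    (H Hp : R -> R) : Prop :=
  forall phi, test1 setT phi ->
    \int[lebesgue_measure]_(q in setT)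
      (((1 + hq (q, 0) ^+ 2) / (2 * hp (q, 0) ^+ 2) - 1 / (2 * Hp 0 ^+ 2)
        + g * (h (q, 0) - H 0)) * phi q)
    - sigma * dist_deriv setT
        (fun q => hq (q, 0) / Num.sqrt (1 + hq (q, 0) ^+ 2)) phi = 0.

Record solitary_wave (R : realType) (g d m sigma : R) (h hq hp : R * R -> R)
    (H Hp : R -> R) : Prop := SolitaryWave {
  (* [inf] is 0 on sets that are not bounded below *)
  sw_inf_hp : 0 < inf (hp @` strip m);
  sw_min_Hp : forall p, p \in `[- m, 0] -> 0 < Hp p;
  sw_H_bed : H (- m) = 0;
  sw_H_top : H 0 = d;
  sw_interior : interior_eq m hq hp Hp;
  sw_surface : surface_eq g sigma h hq hp H Hp;
  sw_bed : forall q, h (q, - m) = 0;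
  sw_right : forall eps, 0 < eps -> \forall q \near +oo,
    forall p, p \in `[- m, 0] ->
      `|hp (q, p) - Hp p| < eps /\ `|hq (q, p)| < eps;
  sw_left : forall eps, 0 < eps -> \forall q \near -oo,
    forall p, p \in `[- m, 0] ->
      `|hp (q, p) - Hp p| < eps /\ `|hq (q, p)| < eps
}.

Definition is_froude (R : realType) (g m : R) (Hp : R -> R) (F : R) : Prop :=
  0 < F /\ 1 / F ^+ 2 = g * \int[lebesgue_measure]_(p in `[- m, 0]) (Hp p ^+ 3).

Definition elevation (R : realType) (h : R * R -> R) (H : R -> R) (q : R) : R :=
  h (q, 0) - H 0.

(* Main.v *)
Require Import Defs.
From mathcomp Require Import all_boot all_order all_algebra.
From mathcomp Require Import all_classical all_reals all_analysis.
From mathcomp Require Import measurable_realfun ring lra.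

Import Order.TTheory GRing.Theory Num.Theory.
Import numFieldNormedType.Exports.

Local Open Scope classical_set_scope.
Local Open Scope ring_scope.

(** Write A = flux_p and B = flux_q, so that A_p + B_q = 0 in the strip, and let
Phi be the primitive of H_p^3 that vanishes on p = -m, so that
g Phi(0) = 1/F^2 by definition of the Froude number.  Multiplying the equation
by Phi and integrating in p over [-m, 0] gives, with the dynamic condition
A = g eta - sigma kappa' on p = 0, where kappa = h_q / (1 + h_q^2)^(1/2),
<<
   d/dq ( int B Phi dp - sigma Phi(0) kappa )
     = int A H_p^3 dp - (1/F^2) eta.
>>
By algebra, A H_p^3 = (h_p - H_p) - I, where I is the integrand of the
statement, and eta = int (h_p - H_p) dp because h = H = 0 on the bed.  The
right-hand side is therefore - ((1/F^2 - 1) eta + int I dp).  Integrating over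
[-M, M] leaves only the values at q = -M and q = M of
int B Phi dp - sigma Phi(0) kappa ([flux_balance]).  They tend to 0 with h_q,
since h_p is bounded below ([flux_vanishes]).

Both equations hold in the sense of distributions only, whereas h_q, h_p and
H_p are continuous up to the boundary.  The computation is thus carried out
once integrated.  Testing the equation with products chi(q) psi(p) and applying
the theorem of Fubini shows that int A chi dq has the weak derivative
int B chi' dq on (-m, 0).  By the lemma of du Bois-Reymond
([du_bois_reymond]) it is its classical derivative, even up to the ends of
[-m, 0], and an integration by parts against Phi is legitimate
([vertical_flux]).  The resulting relation, valid for every chi, is the weak
form of the displayed one, and the lemma of du Bois-Reymond in q gives its
integrated form.

The smooth test functions are built from t |-> t^(-k) exp(-1/t).  Extending
h_q, h_p and H_p to all p by their values at the nearest point of [-m, 0]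
makes every integrand continuous on the whole plane or line, which avoids
one-sided derivatives in the integrations by parts. *)

(** * Integrals and primitives of continuous functions *)

Section Calculus.
Context {R : realType}.
Implicit Types (f F : R -> R) (a b x : R).
Local Notation mu := (@lebesgue_measure R).

Lemma continuous_integrable f a b :
  continuous f -> mu.-integrable `[a, b] (EFin \o f).
Proof.
move=> cf; apply: continuous_compact_integrable; first exact: segment_compact.
exact: continuous_subspaceT.
Qed.

Lemma Rintegral_lincomb c f g a b : continuous f -> continuous g ->
  \int[mu]_(x in `[a, b]) (c * f x + g x) =
  c * \int[mu]_(x in `[a, b]) f x + \int[mu]_(x in `[a, b]) g x.
Proof.
move=> cf cg; have icf := continuous_integrable f a b cf.
rewrite -RintegralZl // -RintegralD //; last exact: continuous_integrable.
by apply: continuous_integrable => x; apply: cvgM; [exact: cvg_cst|exact: cf].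
Qed.

Lemma is_derive_continuous f f' : (forall x, is_derive x 1 f (f' x)) -> continuous f.
Proof.
move=> df x; apply: differentiable_continuous; apply/derivable1_diffP.
by have [] := df x.
Qed.

Lemma Rintegral_FTC2 f F a b : a <= b -> continuous f ->
  (forall x, is_derive x 1 F (f x)) ->
  \int[mu]_(x in `[a, b]) f x = F b - F a.
Proof.
rewrite le_eqVlt => /predU1P[-> | ab] cf dF.
  by rewrite set_itv1 Rintegral_set1 subrr.
rewrite /Rintegral (continuous_FTC2 ab (F := F)) //.
- exact: continuous_subspaceT.
- have cF := is_derive_continuous _ _ dF.
  split.
  + by move=> x _; have [] := dF x.
  + by apply: cvg_at_right_filter; exact: cF.
  + by apply: cvg_at_left_filter; exact: cF.
- by move=> x _; rewrite derive1E; have [_ ->] := dF x.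
Qed.

(** The primitive is defined and differentiable on the whole line, so that
two-sided derivatives can be used at the endpoints of any interval. *)
Lemma primitive_exists f : continuous f ->
  exists F, forall x, is_derive x 1 F (f x).
Proof.
move=> cf.
pose P c x := \int[mu]_(t in `[c, x]) f t.
pose F x := P 0 x - P x 0.
exists F => x0.
have Pab c x y : c <= x -> x <= y -> P c y = P c x + P x y.
  move=> cx xy; rewrite /P.
  have := @Rintegral_itvB R f (BLeft c) (BRight y) x.
  rewrite !bnd_simp => /(_ (continuous_integrable _ _ _ cf) cx xy).
  rewrite Rintegral_itv_obnd_cbnd; first by move=> <-; rewrite addrC subrK.
  apply: integrableS (continuous_integrable _ x y cf) => //.
  exact: subset_itv_oc_cc.
have Pxx x : P x x = 0 by rewrite /P set_itv1 Rintegral_set1.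
have Pgt x y : y < x -> P x y = 0.
  by move=> xy; rewrite /P set_itv_ge ?bnd_simp -?ltNge // Rintegral_set0.
(* Near x0, F differs from P c by a constant, for any c below both 0 and x0. *)
pose c := Num.min 0 x0 - 1.
have c0 : c < 0 by rewrite /c ltrBlDr (le_lt_trans (y := 0)) ?ge_min ?lexx // add0r.
have cx0 : c < x0.
  by rewrite /c ltrBlDr (le_lt_trans (y := x0)) ?ge_min ?lexx ?orbT // ltrDl.
have FE x : c < x -> F x = P c x - P c 0.
  move=> cx; rewrite /F; case: (lerP 0 x) => hx.
    rewrite (Pab c 0 x) ?(ltW c0) // [P c 0 + _]addrC addrK.
    move: hx; rewrite le_eqVlt => /predU1P[<-|hx]; first by rewrite Pxx subr0.
    by rewrite [P x 0]Pgt // subr0.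
  rewrite (Pab c x 0) ?(ltW cx) ?(ltW hx) // opprD addrA subrr sub0r.
  by rewrite [P 0 x]Pgt // sub0r.
have dP : is_derive x0 1 (P c) (f x0).
  have [] := @continuous_FTC1_closed R f c x0 (x0 + 1) _ _ cx0 (cf x0).
  - by rewrite ltrDl.
  - exact: continuous_integrable.
  by move=> d1 d2; apply: DeriveDef => //; rewrite -derive1E.
have dP' : is_derive x0 1 (fun x => P c x - P c 0) (f x0).
  by rewrite -[f x0]subr0; apply: is_deriveB.
apply: near_eq_is_derive dP'.
near=> x; apply/esym/FE; near: x.
exact: lt_nbhsr.
Unshelve. all: by end_near. Qed.

End Calculus.

(** * Smooth test functions *)

Section Smooth.
Context {R : realType}.
Implicit Types (f F : R -> R) (a b x u v : R) (k : nat).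

(** The function t^(-k) exp(-1/t), extended by 0 to t <= 0.  The derivative of
such a function is a combination of two others, which makes them smooth. *)
Definition flat k x : R := if 0 < x then x^-1 ^+ k * expR (- x^-1) else 0.

Lemma flat_ge0 k x : 0 <= flat k x.
Proof.
rewrite /flat; case: ifP => // x0.
by rewrite mulr_ge0 ?expR_ge0 // exprn_ge0 // invr_ge0 ltW.
Qed.

(** A bound that is linear in x suffices to differentiate [flat k] at 0,
because its difference quotient there is [flat k.+1]. *)
Lemma flat_le k x : flat k x <= k.+1%:R ^+ k.+1 * `|x|.
Proof.
rewrite /flat; case: ifP => x0; last by rewrite mulr_ge0 ?exprn_ge0.
rewrite gtr0_norm // expRN ler_pdivrMr ?expR_gt0 //.
(* expR y = expR (y / n) ^+ n >= (y / n) ^+ n, for n = k + 1. *)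
have -> : expR (x^-1) = expR (x^-1 / k.+1%:R) ^+ k.+1.
  by rewrite -expRM_natr divfK ?pnatr_eq0.
have h : x^-1 / k.+1%:R <= expR (x^-1 / k.+1%:R).
  by rewrite (le_trans _ (expR_ge1Dx _)) // lerDr.
apply: (@le_trans _ _ (k.+1%:R ^+ k.+1 * x * (x^-1 / k.+1%:R) ^+ k.+1)).
  rewrite expr_div_n [x^-1 ^+ k.+1]exprS.
  have : k.+1%:R ^+ k.+1 != 0 :> R by rewrite expf_neq0 // pnatr_eq0.
  set N := k.+1%:R ^+ k.+1; set Y := x^-1 ^+ k => N0.
  have xn : x != 0 by rewrite gt_eqF.
  clearbody N Y.
  by rewrite (_ : N * x * _ = Y) //; field; rewrite N0 xn.
rewrite ler_pM2l ?mulr_gt0 ?exprn_gt0 //.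
by rewrite lerXn2r // nnegrE ?expR_ge0 // divr_ge0 // invr_ge0 ltW.
Qed.

Lemma is_derive_flat k x : is_derive x 1 (flat k) (- k%:R * flat k.+1 x + flat k.+2 x).
Proof.
have [x0|x0|->] := ltgtP x 0.
- have -> : - k%:R * flat k.+1 x + flat k.+2 x = 0.
    by rewrite /flat lt_gtF // mulr0 addr0.
  apply: near_eq_is_derive (is_derive_cst 0 x 1).
  near=> y; have y0 : y < 0 by near: y; exact: lt_nbhsl.
  by rewrite /flat lt_gtF.
- have : is_derive x 1 (fun y => y^-1 ^+ k * expR (- y^-1))
      (- k%:R * flat k.+1 x + flat k.+2 x).
    rewrite /flat x0.
    have xn : x != 0 by rewrite gt_eqF.
    have dV : is_derive x (1:R) (@GRing.inv R) (- x ^- 2).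
      have := @is_deriveV R id x 1 1 xn (is_derive_id x (1:R)).
      by rewrite /GRing.scale /= mulr1.
    have dN : is_derive x (1:R) (fun y => - y^-1) (x ^- 2).
      by have := is_deriveN dV; rewrite opprK.
    have dE := is_derive1_comp (f := expR) (is_derive_expR _) dN.
    have dX := is_deriveX k dV.
    have := is_deriveM dX dE.
    rewrite (_ : (GRing.inv ^+ k * _) = (fun y : R => y^-1 ^+ k * expR (- y^-1))).
      move=> dP; apply: is_derive_eq dP _.
      rewrite /GRing.scale /= exprfctE.
      case: (k) => [|j] /=; first by rewrite !exprS !expr0; field.
      by rewrite !exprS; field.
    by apply/funext => y; rewrite exprfctE.
  apply: near_eq_is_derive.
  near=> y; have y0 : 0 < y by near: y; exact: lt_nbhsr.
  by rewrite /flat y0.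
- have fl0 j : flat j 0 = 0 by rewrite /flat ltxx.
  rewrite !fl0 mulr0 addr0.
  suff H : (fun h => h^-1 *: ((flat k \o shift 0) (h *: (1:R)) - flat k 0)) @ 0^' --> (0:R).
    by apply: DeriveDef; [apply/cvg_ex; exists 0|apply/cvg_lim].
  have E h : h^-1 *: ((flat k \o shift 0) (h *: (1:R)) - flat k 0) = flat k.+1 h.
    rewrite fl0 subr0 /= addr0 /GRing.scale /= mulr1 /flat.
    by case: ifP; rewrite ?mulr0 // exprS mulrA.
  under eq_fun do rewrite E.
  apply: (@squeeze_cvgr _ _ _ _ (cst 0) (fun x => k.+2%:R ^+ k.+2 * `|x|)).
  + by near=> h; rewrite flat_ge0 flat_le.
  + exact: cvg_cst.
  + rewrite -[X in _ --> X](mulr0 (k.+2%:R ^+ k.+2)).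
    apply: cvgMr; rewrite -[X in _ --> X](@normr0 R R).
    by apply: cvg_norm; apply: cvg_within_filter; exact: cvg_id.
Unshelve. all: by end_near. Qed.

(** A class of infinitely differentiable functions, presented by generators.  It
is closed under differentiation ([smooth_is_derive]); the last constructor
closes it under primitives. *)
Inductive smooth : (R -> R) -> Prop :=
| smooth_flat k u : smooth (fun t => flat k (t - u))
| smooth_flatN k u : smooth (fun t => flat k (u - t))
| smoothD f g : smooth f -> smooth g -> smooth (fun t => f t + g t)
| smoothM f g : smooth f -> smooth g -> smooth (fun t => f t * g t)
| smoothZ c f : smooth f -> smooth (fun t => c * f t)
| smooth_prim f F : smooth f -> (forall x, is_derive x 1 F (f x)) -> smooth F.

Lemma smooth_is_derive f : smooth f ->
  exists2 f', smooth f' & forall x, is_derive x 1 f (f' x).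
Proof.
elim => {f} [k u|k u|f g sf [f' sf' df] sg [g' sg' dg]
  |f g sf [f' sf' df] sg [g' sg' dg]|c f sf [f' sf' df]|f F sf _ dF].
- exists (fun t => - k%:R * flat k.+1 (t - u) + flat k.+2 (t - u)).
    by apply: smoothD; [apply: smoothZ|]; exact: smooth_flat.
  move=> x; have dxu : is_derive x (1:R) (fun t => t - u) 1.
    by apply: is_derive_eq; rewrite subr0.
  apply: is_derive_eq (is_derive1_comp (f := flat k) (is_derive_flat _ _) dxu) _.
  by rewrite /GRing.scale /= mulr1.
- exists (fun t => - 1 * (- k%:R * flat k.+1 (u - t) + flat k.+2 (u - t))).
    by apply: smoothZ; apply: smoothD; [apply: smoothZ|]; exact: smooth_flatN.
  move=> x; have dxu : is_derive x (1:R) (fun t => u - t) (-1).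
    by have := is_deriveB (is_derive_cst u x (1:R)) (is_derive_id x (1:R)); rewrite sub0r.
  apply: is_derive_eq (is_derive1_comp (f := flat k) (is_derive_flat _ _) dxu) _.
  by rewrite /GRing.scale /= mulrC.
- exists (fun t => f' t + g' t); first exact: smoothD.
  by move=> x; exact: is_deriveD.
- exists (fun t => f t * g' t + g t * f' t).
    by apply: smoothD; exact: smoothM.
  by move=> x; exact: is_deriveM.
- exists (fun t => c * f' t); first exact: smoothZ.
  by move=> x; exact: is_deriveZ.
- by exists f.
Qed.

Lemma smooth_derive1 f : smooth f -> smooth f^`()%classic.
Proof.
move=> /smooth_is_derive[f' sf' df].
rewrite (_ : f^`()%classic = f') //; apply/funext => x.
by rewrite derive1E; have [_ ->] := df x.
Qed.

Lemma smooth_derivable f x : smooth f -> derivable f x 1.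
Proof. by move=> /smooth_is_derive[f' _ /(_ x)[]]. Qed.

Lemma smooth_isd f x : smooth f -> is_derive x 1 f (f^`()%classic x).
Proof. by move=> sf; rewrite derive1E; apply: derivableP; exact: smooth_derivable. Qed.

Lemma smooth_continuous f : smooth f -> continuous f.
Proof. by move=> sf; apply: is_derive_continuous (fun x => smooth_isd f x sf). Qed.

Lemma smooth_derive1n f n : smooth f -> smooth f^`(n)%classic.
Proof. by move=> sf; elim: n => [|n IH] //=; exact: smooth_derive1. Qed.

Lemma smooth_test1 (D : set R) f u v : smooth f -> `[u, v] `<=` D ->
  (forall x, x \notin `[u, v] -> f x = 0) -> test1 D f.
Proof.
move=> sf uvD f0; split.
  by move=> n x; apply: smooth_derivable; exact: smooth_derive1n.
exists [set` `[u, v]]; split => //; first exact: segment_compact.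
by move=> x xuv; apply: f0; apply/negP.
Qed.

(** The product function f(q) g(p) on the plane. *)
Definition tprod (f g : R -> R) (z : R * R) : R := f z.1 * g z.2.

Lemma differentiable_tprod f g z : smooth f -> smooth g ->
  differentiable (tprod f g) z.
Proof.
move=> sf sg.
have df : differentiable f z.1.
  by apply/derivable1_diffP; exact: smooth_derivable.
have dg : differentiable g z.2.
  by apply/derivable1_diffP; exact: smooth_derivable.
apply: differentiableM.
- apply: (@differentiable_comp _ _ _ _ fst f) => //.
  by apply: linear_differentiable; move=> w; exact: cvg_fst.
- apply: (@differentiable_comp _ _ _ _ snd g) => //.
  by apply: linear_differentiable; move=> w; exact: cvg_snd.
Qed.

Lemma derive_tprod_q f g z : smooth f -> smooth g ->
  'D_e_q (tprod f g) z = tprod f^`()%classic g z.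
Proof.
move=> sf sg.
transitivity ('D_1 (fun x => g z.2 * f x) z.1).
  rewrite /derive; set A := (fun h => _); set B := (fun h => _).
  suff -> : A = B by []; apply/funext => h; rewrite /A /B.
  by rewrite /tprod /= scaler0 add0r ![g _ * _]mulrC.
have [_ ->] : is_derive z.1 1 (fun x => g z.2 * f x) (g z.2 * f^`()%classic z.1).
  by apply: is_deriveZ; exact: smooth_isd.
by rewrite /tprod mulrC.
Qed.

Lemma derive_tprod_p f g z : smooth f -> smooth g ->
  'D_e_p (tprod f g) z = tprod f g^`()%classic z.
Proof.
move=> sf sg.
transitivity ('D_1 (fun x => f z.1 * g x) z.2).
  rewrite /derive; set A := (fun h => _); set B := (fun h => _).
  suff -> : A = B by []; apply/funext => h; rewrite /A /B.
  by rewrite /tprod /= scaler0 add0r.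
have [_ ->] // : is_derive z.2 1 (fun x => f z.1 * g x) (f z.1 * g^`()%classic z.2).
by apply: is_deriveZ; exact: smooth_isd.
Qed.

Lemma tprod_iter_partial f g s : smooth f -> smooth g ->
  exists f' g', [/\ smooth f', smooth g' & iter_partial s (tprod f g) = tprod f' g'].
Proof.
move=> sf sg; elim: s => [|b s [f' [g' [sf' sg' E]]]]; first by exists f, g.
rewrite /= E; case: b.
- exists f'^`()%classic, g'; split => //; first exact: smooth_derive1.
  by apply/funext => z; exact: derive_tprod_q.
- exists f', g'^`()%classic; split => //; first exact: smooth_derive1.
  by apply/funext => z; exact: derive_tprod_p.
Qed.

Lemma tprod_test2 (D : set (R * R)) f g u v s t : smooth f -> smooth g ->
  `[u, v] `*` `[s, t] `<=` D ->
  (forall x, x \notin `[u, v] -> f x = 0) ->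
  (forall x, x \notin `[s, t] -> g x = 0) -> test2 D (tprod f g).
Proof.
move=> sf sg uvD f0 g0; split.
  move=> l z; have [f' [g' [sf' sg' ->]]] := tprod_iter_partial _ _ l sf sg.
  exact: differentiable_tprod.
exists (`[u, v] `*` `[s, t]); split => //.
  by apply: compact_setX; exact: segment_compact.
move=> [x y] /not_andP[] /= h; rewrite /tprod /=.
- by rewrite f0 ?mul0r //; apply/negP.
- by rewrite g0 ?mulr0 //; apply/negP.
Qed.

End Smooth.

(** * The lemma of du Bois-Reymond *)

Section DuBoisReymond.
Context {R : realType}.
Implicit Types (f F S : R -> R) (a b x u v : R) (k : nat).
Local Notation mu := (@lebesgue_measure R).

Lemma bump_exists u v : u < v -> exists rho : R -> R, [/\ smooth rho,
  forall x, 0 <= rho x, forall x, x \notin `]u, v[ -> rho x = 0 &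
  forall a b, a <= u -> v <= b -> 0 < \int[mu]_(x in `[a, b]) rho x].
Proof.
move=> uv; pose rho x : R := flat 0 (x - u) * flat 0 (v - x).
have srho : smooth rho.
  by apply: smoothM; [exact: smooth_flat|exact: smooth_flatN].
have rho0 x : 0 <= rho x by rewrite mulr_ge0 ?flat_ge0.
exists rho; split => //.
  move=> x; rewrite in_itv /= negb_and -!leNgt => /orP[xu|vx].
    by rewrite /rho /flat (le_gtF (x := x - u)) ?mul0r // subr_le0.
  by rewrite /rho /flat (le_gtF (x := v - x)) ?mulr0 // subr_le0.
move=> a b au vb.
have crho := smooth_continuous _ srho.
have [P dP] := primitive_exists _ crho.
have Pm x y : x <= y -> P x <= P y.
  move=> xy; rewrite -subr_ge0 -(Rintegral_FTC2 _ _ _ _ xy crho dP).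
  by apply: Rintegral_ge0.
rewrite (Rintegral_FTC2 _ _ _ _ _ crho dP); last first.
  by rewrite (le_trans au) // (le_trans (ltW uv)).
have [c cuv E] : exists2 c, c \in `]u, v[ & P v - P u = rho c * (v - u).
  apply: MVT => //; apply: continuous_subspaceT.
  exact: is_derive_continuous dP.
have rc : 0 < rho c.
  move: cuv; rewrite in_itv /= => /andP[uc cv].
  by rewrite /rho /flat !subr_gt0 uc cv !mulr_gt0 ?expr0 ?expR_gt0.
have : 0 < P v - P u by rewrite E mulr_gt0 // subr_gt0.
have := Pm _ _ au; have := Pm _ _ vb; lra.
Qed.

(** The interval [u, v] lies in the open interval ]a, b[, even if x is an
endpoint: this is what extends conclusions from ]a, b[ to [a, b]. *)
Lemma lt_interval S a b x c : continuous S -> a < b -> x \in `[a, b] ->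
  S x < c -> exists u v, [/\ a < u, u < v, v < b &
    forall t, t \in `[u, v] -> S t <= c].
Proof.
move=> cS ab; rewrite in_itv /= => /andP[ax xb] Sx.
have := cvgr_lt (S x) (cS x) c Sx.
case=> e /= e0 He.
have {}He t : `|x - t| < e -> S t <= c by move=> /He /ltW.
move: xb; rewrite le_eqVlt => /predU1P[xb|xb].
- subst x; pose dl := Num.min e (b - a).
  have dl0 : 0 < dl by rewrite lt_min e0 subr_gt0.
  have dle : dl <= e by rewrite ge_min lexx.
  have dla : dl <= b - a by rewrite ge_min lexx orbT.
  exists (b - dl / 2), (b - dl / 3); split; [lra|lra|lra|].
  move=> t; rewrite in_itv /= => /andP[t1 t2]; apply: He.
  by rewrite gtr0_norm; lra.
- pose dl := Num.min e (b - x).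
  have dl0 : 0 < dl by rewrite lt_min e0 subr_gt0.
  have dle : dl <= e by rewrite ge_min lexx.
  have dla : dl <= b - x by rewrite ge_min lexx orbT.
  exists (x + dl / 3), (x + dl / 2); split; [lra|lra|lra|].
  move=> t; rewrite in_itv /= => /andP[t1 t2]; apply: He.
  by rewrite distrC gtr0_norm; lra.
Qed.

(** The test functions on the open interval ]a, b[. *)
Definition test_in a b (chi : R -> R) := smooth chi /\
  exists u v, [/\ a < u, u <= v, v < b & forall x, x \notin `[u, v] -> chi x = 0].

(** A bound on S over the support of the weight rho bounds the rho-average of S. *)
Lemma Rintegral_le_supp S (rho : R -> R) a b u v c : continuous S -> smooth rho ->
  (forall x, 0 <= rho x) -> (forall x, x \notin `]u, v[ -> rho x = 0) ->
  (forall t, t \in `[u, v] -> S t <= c) ->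
  \int[mu]_(x in `[a, b]) (S x * rho x) <= c * \int[mu]_(x in `[a, b]) rho x.
Proof.
move=> cS srho rho0 rhos Sc.
have crho := smooth_continuous _ srho.
rewrite -RintegralZl //; last exact: continuous_integrable.
apply: le_Rintegral => //.
- by apply: continuous_integrable => x; apply: continuousM; [exact: cS|exact: crho].
- by apply: continuous_integrable => x; apply: continuousM; [exact: cst_continuous|exact: crho].
move=> x _; have [xuv|xuv] := boolP (x \in `]u, v[).
  by rewrite ler_wpM2r // Sc // (subset_itv_oo_cc xuv).
by rewrite rhos // !mulr0.
Qed.

(** If the weak derivative of the continuous function S vanishes on ]a, b[, then S
is constant on [a, b].  The conclusion is one inequality: x and y play
symmetric roles.  If S y < S x, let r1 and r2 be bumps near y and x; the
difference of the normalized bumps has integral 0, hence is the derivative of a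
test function, and S would have the same average against both. *)
Lemma vanish_deriv_const S a b : a < b -> continuous S ->
  (forall chi, test_in a b chi ->
     \int[mu]_(x in `[a, b]) (S x * chi^`()%classic x) = 0) ->
  forall x y, x \in `[a, b] -> y \in `[a, b] -> S x <= S y.
Proof.
move=> ab cS H x y xab yab; rewrite leNgt; apply/negP => Syx.
have [c [c' [h1 h2 h3]]] : exists c c', [/\ S y < c, c < c' & c' < S x].
  exists ((2 * S y + S x) / 3), ((S y + 2 * S x) / 3); split; lra.
have [u1 [v1 [au1 uv1 vb1 S1]]] := lt_interval S a b y c cS ab yab h1.
have cNS : continuous (fun t => - S t).
  by move=> t; apply: continuousN; exact: cS.
have h3' : - S x < - c' by rewrite ltrN2.
have [u2 [v2 [au2 uv2 vb2 S2]]] := lt_interval _ a b x (- c') cNS ab xab h3'.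
have [r1 [s1 p1 z1 /(_ a b (ltW au1) (ltW vb1)) i1]] := bump_exists _ _ uv1.
have [r2 [s2 p2 z2 /(_ a b (ltW au2) (ltW vb2)) i2]] := bump_exists _ _ uv2.
set I1 := \int[mu]_(x in _) _ in i1; set I2 := \int[mu]_(x in _) _ in i2.
pose rho t := I1^-1 * r1 t + - I2^-1 * r2 t.
have srho : smooth rho by apply: smoothD; exact: smoothZ.
have crho := smooth_continuous _ srho.
have ci1 : mu.-integrable `[a, b] (EFin \o r1).
  by apply: continuous_integrable; exact: smooth_continuous.
have ci2 : mu.-integrable `[a, b] (EFin \o r2).
  by apply: continuous_integrable; exact: smooth_continuous.
have cc c0 (f : R -> R) : continuous f -> continuous (fun t => c0 * f t).
  by move=> cf t; apply: continuousM; [exact: cst_continuous|exact: cf].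
have cr1 := smooth_continuous _ s1.
have cr2 := smooth_continuous _ s2.
have [P dP] := primitive_exists _ crho.
pose u := Num.min u1 u2; pose v := Num.max v1 v2.
have rho0 t : t <= u \/ v <= t -> rho t = 0.
  move=> h.
  have t1 : t \notin `]u1, v1[.
    rewrite in_itv /= negb_and -!leNgt.
    by case: h; rewrite ?le_min ?ge_max => /andP[-> _]; rewrite ?orbT.
  have t2 : t \notin `]u2, v2[.
    rewrite in_itv /= negb_and -!leNgt.
    by case: h; rewrite ?le_min ?ge_max => /andP[_ ->]; rewrite ?orbT.
  by rewrite /rho z1 // z2 // !mulr0 addr0.
have au : a < u by rewrite lt_min au1.
have vb : v < b by rewrite gt_max vb1.
have uv : u <= v by rewrite ge_min !le_max (ltW uv1).
have Pab : P b = P a.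
  apply/eqP; rewrite -subr_eq0 -(Rintegral_FTC2 _ _ _ _ (ltW ab) crho dP).
  rewrite RintegralD //; try (apply: continuous_integrable; exact: cc).
  have n1 : I1 != 0 by rewrite gt_eqF.
  have n2 : I2 != 0 by rewrite gt_eqF.
  by rewrite !RintegralZl // mulNr !mulVf // subrr.
have Pc s t : s <= t -> (forall r, r \in `[s, t] -> r <= u \/ v <= r) -> P s = P t.
  move=> st h; apply/esym/eqP; rewrite -subr_eq0.
  rewrite -(Rintegral_FTC2 _ _ _ _ st crho dP).
  apply/eqP; rewrite -[RHS](mul0r (fine (mu `[s, t]))) -Rintegral_cst //.
  by apply: eq_Rintegral => r /set_mem /h /rho0.
(* chi is the primitive of rho that vanishes at a; it vanishes at b as well. *)
pose chi t := P t + -1 * P a.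
have schi : smooth chi.
  apply: (smooth_prim rho) => // t; rewrite -[rho t]addr0.
  by apply: is_deriveD.
have dchi : chi^`()%classic = rho.
  apply/funext => t; rewrite derive1E.
  have [_ ->] // : is_derive t 1 chi (rho t).
  by rewrite -[rho t]addr0; apply: is_deriveD.
have chi0 t : t \notin `[u, v] -> chi t = 0.
  rewrite in_itv /= negb_and -!ltNge /chi mulN1r => h; apply/eqP; rewrite subr_eq0.
  case/orP: h => h.
    have [ta|/ltW ta] := leP t a.
      rewrite (Pc t a) // => r; rewrite in_itv /= => /andP[_ ra].
      by left; rewrite (le_trans ra) // ltW.
    rewrite (Pc a t) // => r; rewrite in_itv /= => /andP[_ ra].
    by left; rewrite (le_trans ra) // ltW.
  rewrite -Pab.
  have [ta|/ltW ta] := leP t b.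
    rewrite (Pc t b) // => r; rewrite in_itv /= => /andP[ra _].
    by right; rewrite (le_trans _ ra) // ltW.
  rewrite (Pc b t) // => r; rewrite in_itv /= => /andP[ra _].
  by right; rewrite (le_trans _ ra) // ltW.
have cSM (f : R -> R) : continuous f -> continuous (fun t => S t * f t).
  by move=> cf t; apply: continuousM; [exact: cS|exact: cf].
have tchi : test_in a b chi by split => //; exists u, v; split.
have := H _ tchi; rewrite dchi.
have -> : (fun t => S t * rho t) =
    (fun t => I1^-1 * (S t * r1 t) + - I2^-1 * (S t * r2 t)).
  by apply/funext => t; rewrite /rho; ring.
rewrite RintegralD //; try by apply: continuous_integrable; apply: cc; exact: cSM.
rewrite !RintegralZl //; try by apply: continuous_integrable; exact: cSM.
have h4 := Rintegral_le_supp S r1 a b u1 v1 c cS s1 p1 z1 S1.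
have h5 : c' * I2 <= \int[mu]_(t in `[a, b]) (S t * r2 t).
  have := Rintegral_le_supp (fun t => - S t) r2 a b u2 v2 (- c') cNS s2 p2 z2 S2.
  have -> : (fun t => - S t * r2 t) = (fun t => -1 * (S t * r2 t)).
    by apply/funext => t; ring.
  rewrite RintegralZl //; last by apply: continuous_integrable; exact: cSM.
  rewrite !mulNr mul1r lerN2; apply.
rewrite -/I1 in h4.
apply/eqP; rewrite lt_eqF // mulNr subr_lt0.
apply: (@le_lt_trans _ _ c); first by rewrite mulrC ler_pdivrMr.
by apply: (lt_le_trans h2); rewrite mulrC ler_pdivlMr.
Qed.

(** If E is continuous and has the weak derivative D on ]a, b[, D continuous, then
E and the classical primitive W of D differ by a constant on [a, b]. *)
Lemma du_bois_reymond (E D W : R -> R) a b : a < b ->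
  continuous E -> continuous D -> (forall x, is_derive x 1 W (D x)) ->
  (forall chi, test_in a b chi ->
     \int[mu]_(x in `[a, b]) (E x * chi^`()%classic x + D x * chi x) = 0) ->
  forall x y, x \in `[a, b] -> y \in `[a, b] -> E x - W x = E y - W y.
Proof.
move=> ab cE cD dW H.
have cW := is_derive_continuous _ _ dW.
have cS : continuous (fun t => E t - W t).
  by move=> t; apply: continuousB; [exact: cE|exact: cW].
suff K x y : x \in `[a, b] -> y \in `[a, b] -> E x - W x <= E y - W y.
  by move=> x y hx hy; apply/eqP; rewrite eq_le !K.
apply: (vanish_deriv_const (fun t => E t - W t)) => // chi tc.
have [schi [u [v [au uv vb chi0]]]] := tc.
have cchi := smooth_continuous _ schi.
have cchi' := smooth_continuous _ (smooth_derive1 _ schi).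
have dWchi (t : R) : is_derive t (1:R) (fun t => W t * chi t) (W t * chi^`()%classic t + D t * chi t).
  rewrite [D t * _]mulrC; apply: is_deriveM; exact: smooth_isd.
have cM (f g : R -> R) : continuous f -> continuous g -> continuous (fun t => f t * g t).
  by move=> cf cg t; apply: continuousM; [exact: cf|exact: cg].
have cWc : continuous (fun t => W t * chi^`()%classic t + D t * chi t).
  by move=> t; apply: cvgD; apply: cM.
have := Rintegral_FTC2 _ _ _ _ (ltW ab) cWc dWchi.
rewrite !chi0 ?mulr0 ?subrr; first last.
- by rewrite in_itv /= negb_and -!ltNge ?au ?vb ?orbT.
- by rewrite in_itv /= negb_and -!ltNge ?au ?vb ?orbT.
move=> E2; rewrite -[LHS]subr0 -[X in _ - X]oppr0 -{1}E2.
rewrite -[RHS](H _ tc) opprK -RintegralD //.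
- by apply: eq_Rintegral => t _; ring.
- apply: continuous_integrable; apply: cM => //.
- exact: continuous_integrable.
Qed.

End DuBoisReymond.

(** * Continuous functions on the plane and the theorem of Fubini *)

Section Plane.
Context {R : realType}.
Implicit Types (f : R * R -> R) (U : set (R * R)) (a b c d : R).
Local Notation mu := (@lebesgue_measure R).
Local Notation RR := (measurableTypeR R * measurableTypeR R)%type.

(** An open set of the plane is a countable union of open rectangles with
rational vertices. *)
Lemma open2_measurable U : open U -> measurable (U : set RR).
Proof.
move=> oU.
pose B (a b c d : rat) : set RR :=
  `]ratr a, ratr b[%classic `*` `]ratr c, ratr d[%classic.
pose G (a b c d : rat) : set RR := if `[< B a b c d `<=` U >] then B a b c d else set0.
have -> : U = \bigcup_a \bigcup_b \bigcup_c \bigcup_d G a b c d.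
  apply/seteqP; split => [[x y] Uxy|z]; last first.
    move=> [a _ [b _ [c _ [d _]]]]; rewrite /G; case: asboolP => // BU.
    exact: BU.
  move: oU; rewrite openE => /(_ _ Uxy) /nbhs_ballP[e /= e0 eU].
  have /rat_in_itvoo[a aH] : ((x - e) < x) by rewrite ltrBlDr ltrDl.
  have /rat_in_itvoo[b bH] : (x < (x + e)) by rewrite ltrDl.
  have /rat_in_itvoo[c cH] : ((y - e) < y) by rewrite ltrBlDr ltrDl.
  have /rat_in_itvoo[d dH] : (y < (y + e)) by rewrite ltrDl.
  move: aH bH cH dH; rewrite !in_itv /= => /andP[a1 a2] /andP[b1 b2] /andP[c1 c2] /andP[d1 d2].
  exists a => //; exists b => //; exists c => //; exists d => //.
  have BU : B a b c d `<=` U.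
    move=> [s t] [] /=; rewrite !in_itv /= => /andP[s1 s2] /andP[t1 t2].
    by apply: eU; split; rewrite /ball /= ltr_distlC; apply/andP; split; lra.
  rewrite /G (asboolT BU).
  by split; rewrite /= in_itv /= ?a2 ?b1 ?c2 ?d1.
do 4 apply: bigcupT_measurable_rat => ?.
rewrite /G; case: ifP => // _.
by apply: measurableX; exact: measurable_itv.
Qed.

Lemma continuous2_measurable f : continuous f -> measurable_fun setT (f : RR -> R).
Proof.
move=> /continuousP cf; apply: (measurability _ (RGenOpens.measurableE R)).
move=> _ [_ [a [b ->] <-]]; rewrite setTI; apply: open2_measurable.
exact/cf/interval_open.
Qed.

Lemma continuous_pair (T : topologicalType) (f g : T -> R) :
  continuous f -> continuous g -> continuous (fun t => (f t, g t)).
Proof. by move=> cf cg t; apply: (cvg_pair (cf t) (cg t)). Qed.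

Lemma continuous_pair_comp (T : topologicalType) (u v : T -> R) f :
  continuous f -> continuous u -> continuous v ->
  continuous (fun t => f (u t, v t)).
Proof.
move=> cf cu cv t; apply: (@continuous_comp _ _ _ (fun t => (u t, v t)) f).
  exact: continuous_pair.
exact: cf.
Qed.

Lemma continuous_section1 f y : continuous f -> continuous (fun x => f (x, y)).
Proof.
move=> cf; apply: (continuous_pair_comp _ id (cst y)) => // x; first exact: cvg_id.
exact: cvg_cst.
Qed.

Lemma continuous_section2 f x : continuous f -> continuous (fun y => f (x, y)).
Proof.
move=> cf; apply: (continuous_pair_comp _ (cst x) id) => // y; last exact: cvg_id.
exact: cvg_cst.
Qed.

Definition box a b c d : set (R * R) := `[a, b] `*` `[c, d].

Lemma in_box a b c d (x y : R) :
  ((x, y) \in box a b c d) = (x \in `[a, b]%classic) && (y \in `[c, d]%classic).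
Proof. by apply/idP/andP; rewrite !inE. Qed.

Lemma bounded_box f a b c d : continuous f ->
  exists K, forall z, box a b c d z -> `|f z| <= K.
Proof.
move=> cf.
have cpt : compact (box a b c d) by apply: compact_setX; exact: segment_compact.
have /compact_bounded[M [_ HM]] : compact (f @` box a b c d).
  by apply: continuous_compact => //; exact: continuous_subspaceT.
exists (M + 1) => z bz; apply: (HM (M + 1)); first by rewrite ltrDl.
by exists z.
Qed.

Lemma box_integrable f a b c d : continuous f ->
  (leb2 : {measure set RR -> \bar R}).-integrable setT
     (fun z => ((f \_ (box a b c d)) z)%:E).
Proof.
move=> cf.
have mb : measurable (box a b c d : set RR).
  by apply: measurableX; exact: measurable_itv.
have -> : (fun z => ((f \_ (box a b c d)) z)%:E) = (EFin \o f) \_ (box a b c d).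
  by rewrite restrict_EFin.
apply: (proj1 (integrable_mkcond _ mb)).
apply: measurable_bounded_integrable => //.
- have fin (u v : R) : mu `[u, v] \is a fin_num.
    by rewrite lebesgue_measure_itv /=; case: ifP.
  have boxE := product_measure1E mu mu (measurable_itv `[a, b]) (measurable_itv `[c, d]).
  rewrite [X in (X < _)%E]boxE.
  by rewrite ltey_eq; apply/orP; left; apply: fin_numM; exact: fin.
- exact: measurable_funTS (continuous2_measurable _ cf).
- have [K HK] := bounded_box _ a b c d cf.
  exists K; split; first exact: num_real.
  by move=> x Kx z bz /=; rewrite (le_trans (HK _ bz)) // ltW.
Qed.

(** The integral of f over D when f, extended by 0 outside D, coincides with the
restriction of a continuous function g to a box: both iterated integrals of g
compute it. *)
Lemma fubini_box f (g : R * R -> R) (D : set (R * R)) a b c d : continuous g ->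
  (forall z, (f \_ D) z = (g \_ (box a b c d)) z) ->
  \int[leb2]_(z in D) f z =
    \int[mu]_(x in `[a, b]) \int[mu]_(y in `[c, d]) g (x, y) /\
  \int[leb2]_(z in D) f z =
    \int[mu]_(y in `[c, d]) \int[mu]_(x in `[a, b]) g (x, y).
Proof.
move=> cg fg; rewrite Rintegral_mkcond (funext fg).
have ig := box_integrable g a b c d cg.
split; rewrite /Rintegral.
- rewrite -(integral12_prod_meas1 ig); congr fine.
  rewrite [RHS]integral_mkcond; apply: eq_integral => x _.
  rewrite /fubini_F patchE; case: ifPn => xab.
    rewrite fineK; last first.
      by apply: integrable_fin_num => //; apply: continuous_integrable; exact: continuous_section2.
    rewrite [RHS]integral_mkcond; apply: eq_integral => y _.
    by rewrite !patchE in_box xab /=; case: ifP.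
  by apply: integral0_eq => y _; rewrite patchE in_box (negbTE xab).
- rewrite -(integral21_prod_meas1 ig); congr fine.
  rewrite [RHS]integral_mkcond; apply: eq_integral => y _.
  rewrite /fubini_G patchE; case: ifPn => ycd.
    rewrite fineK; last first.
      by apply: integrable_fin_num => //; apply: continuous_integrable; exact: continuous_section1.
    rewrite [RHS]integral_mkcond; apply: eq_integral => x _.
    by rewrite !patchE in_box ycd andbT /=; case: ifP.
  by apply: integral0_eq => x _; rewrite patchE in_box (negbTE ycd) andbF.
Qed.

Lemma Rintegral_swap (g : R * R -> R) a b c d : continuous g ->
  \int[mu]_(x in `[a, b]) \int[mu]_(y in `[c, d]) g (x, y) =
  \int[mu]_(y in `[c, d]) \int[mu]_(x in `[a, b]) g (x, y).
Proof. by move=> cg; have [<- <-] := fubini_box g g (box a b c d) a b c d cg (fun=> erefl). Qed.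

Lemma continuous_param (g : R * R -> R) c d : continuous g ->
  continuous (fun x => \int[mu]_(y in `[c, d]) g (x, y)).
Proof.
move=> cg x0.
have [K HK] := bounded_box _ (x0 - 1) (x0 + 1) c d cg.
apply: (@continuity_under_integral _ _ _ mu (fun x y => g (x, y)) `[c, d]
   (measurable_itv _) (x0 - 1) (x0 + 1) _ _ (fun=> K)).
- by move=> x _; apply: continuous_integrable; exact: continuous_section2.
- by apply: aeW => y _ x _; exact: continuous_section1.
- by apply: continuous_integrable => ?; exact: cvg_cst.
- move=> x Ix; apply: aeW => y cdy; apply: HK; split => //=.
  exact: subset_itv_oo_cc Ix.
- by rewrite inE /= in_itv /=; apply/andP; split; lra.
Qed.

Lemma continuous_param2 (g : R * R -> R) a b : continuous g ->
  continuous (fun y => \int[mu]_(x in `[a, b]) g (x, y)).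
Proof.
move=> cg; apply: (continuous_param (fun z => g (z.2, z.1))).
apply: (continuous_pair_comp _ snd fst) => // z; [exact: cvg_snd|exact: cvg_fst].
Qed.

End Plane.

(** * Extension from the closed strip to the plane *)

Section Clamp.
Context {R : realType}.
Variable m : R.
Hypothesis m_gt0 : 0 < m.
Local Notation mu := (@lebesgue_measure R).

(** The point of [-m, 0] nearest to p.  Composition with [clamp] extends functions
of p in [-m, 0] to the whole line. *)
Definition clamp (p : R) : R := Num.max (- m) (Num.min p 0).

Lemma clamp_itv p : clamp p \in `[- m, 0].
Proof.
rewrite in_itv /= /clamp le_max lexx /= ge_max ge_min lexx orbT andbT.
by rewrite oppr_le0 ltW.
Qed.

Lemma clamp_id p : p \in `[- m, 0] -> clamp p = p.
Proof.
by rewrite in_itv /= /clamp => /andP[p1 p2]; rewrite min_l // max_r.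
Qed.

Lemma clamp_lip p q : `|clamp p - clamp q| <= `|p - q|.
Proof.
have mm := m_gt0.
wlog pq : p q / p <= q => [H|].
  by case/orP: (le_total p q) => /H //; rewrite distrC (distrC q).
rewrite [leRHS]ler0_norm ?subr_le0 // ler_norml /clamp.
have [p0|p0] := leP p 0; have [q0|q0] := leP q 0.
- by case: (leP (- m) p) => ?; case: (leP (- m) q) => ?; apply/andP; split; lra.
- by case: (leP (- m) p) => ?; case: (leP (- m) 0) => ?; apply/andP; split; lra.
- by case: (leP (- m) 0) => ?; case: (leP (- m) q) => ?; apply/andP; split; lra.
- by case: (leP (- m) 0) => ?; apply/andP; split; lra.
Qed.

Lemma continuous_clamp : continuous clamp.
Proof.
move=> p; apply/cvgrPdist_lt => e e0; near=> q.
apply: (le_lt_trans (clamp_lip _ _)); near: q.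
by apply: cvgr_dist_lt => //; exact: cvg_id.
Unshelve. all: by end_near. Qed.

Lemma continuous_comp_clamp (f : R -> R) :
  {within `[- m, 0], continuous f} -> continuous (f \o clamp).
Proof.
move=> /subspace_continuousP cf p.
apply: (@cvg_comp _ _ _ clamp f _ (within [set` `[- m, 0]] (nbhs (clamp p)))); last first.
  by apply: cf; exact: clamp_itv.
move=> P /= wP.
have H : \forall q \near p, `[- m, 0]%classic (clamp q) -> P (clamp q).
  exact: (@continuous_clamp p _ wP).
by apply: filterS H => q; apply; exact: clamp_itv.
Qed.

Lemma holder_continuous_clamp alpha (f : R * R -> R) : 0 < alpha ->
  holder_loc_cstrip m alpha f -> continuous (fun z => f (z.1, clamp z.2)).
Proof.
move=> alpha0 hf z; pose M := `|z.1| + 1.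
have M0 : 0 < M by rewrite ltr_pwDr.
have [C HC] := hf M M0.
apply/cvgrPdist_lt => e e0.
pose e1 := e / (`|C| + 1).
have e10 : 0 < e1 by rewrite divr_gt0 // ltr_pwDr.
pose dl := e1 `^ alpha^-1.
have dl0 : 0 < dl by exact: powR_gt0.
near=> w.
have zw1 : `|z - w| < 1.
  by near: w; apply: cvgr_dist_lt => //; exact: cvg_id.
have zwd : `|z - w| < dl.
  by near: w; apply: cvgr_dist_lt => //; exact: cvg_id.
have norm1 : `|z.1 - w.1| <= `|z - w| by rewrite prod_normE /= le_max lexx.
have norm2 : `|z.2 - w.2| <= `|z - w| by rewrite prod_normE /= le_max lexx orbT.
have wM : w.1 \in `[- M, M].
  rewrite in_itv /= -ler_norml /M.
  have -> : w.1 = z.1 - (z.1 - w.1) by ring.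
  by rewrite (le_trans (ler_normB _ _)) // lerD2l (le_trans norm1) // ltW.
have zM : z.1 \in `[- M, M].
  by rewrite in_itv /= -ler_norml /M lerDl.
have := HC (z.1, clamp z.2) (w.1, clamp w.2).
move=> /(_ (conj zM (clamp_itv _)) (conj wM (clamp_itv _))) h.
apply: (le_lt_trans h).
have nle : `|(z.1, clamp z.2) - (w.1, clamp w.2)| <= `|z - w|.
  by rewrite prod_normE /= ge_max norm1 (le_trans (clamp_lip _ _)).
have pw : `|(z.1, clamp z.2) - (w.1, clamp w.2)| `^ alpha <= e1.
  have -> : e1 = dl `^ alpha.
    by rewrite /dl -powRrM mulVf ?gt_eqF // powRr1 // ltW.
  apply: ge0_ler_powR; rewrite ?nnegrE ?(ltW alpha0) ?(ltW dl0) //.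
  exact/ltW/(le_lt_trans nle).
apply: (@le_lt_trans _ _ (`|C| * e1)).
  apply: (@le_trans _ _ (`|C| * `|(z.1, clamp z.2) - (w.1, clamp w.2)| `^ alpha)).
    by rewrite ler_wpM2r ?powR_ge0 ?ler_norm.
  by rewrite ler_wpM2l.
rewrite /e1 mulrA ltr_pdivrMr ?ltr_pwDr // mulrC ltr_pM2l //.
by rewrite ltrDl.
Unshelve. all: by end_near. Qed.

Lemma within_section (f : R * R -> R) x :
  {within cstrip m, continuous f} -> {within `[- m, 0], continuous (fun p => f (x, p))}.
Proof.
move=> /subspace_continuousP cf; apply/subspace_continuousP => p pm.
apply: (@cvg_comp _ _ _ (fun p => (x, p)) f _ (within (cstrip m) (nbhs (x, p)))); last first.
  by apply: cf; split.
move=> P /= wP.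
have cx : continuous (fun q : R => (x, q)).
  by apply: (continuous_pair _ (cst x) id) => q; [exact: cvg_cst|exact: cvg_id].
have : \forall q \near p, cstrip m (x, q) -> P (x, q) by exact: (cx p _ wP).
by apply: filterS => q h qm; apply: h; split.
Qed.

Lemma is_derive_section (f : R * R -> R) x p df :
  is_derive (x, p) e_p f df -> is_derive p (1:R) (fun q => f (x, q)) df.
Proof.
have E : (fun h : R => h^-1 *: (((fun q => f (x, q)) \o shift p) (h *: (1:R)) - f (x, p)))
   = (fun h : R => h^-1 *: ((f \o shift (x, p)) (h *: (e_p : R * R)) - f (x, p))).
  apply/funext => h; rewrite /= /shift /=.
  by have -> : h *: (e_p : R * R) + (x, p) = (x, h *: (1:R) + p)
    by rewrite /e_p; congr (_, _); rewrite /= scaler0 add0r.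
case=> d v; apply: DeriveDef.
  by rewrite /derivable E.
by rewrite -v /derive E.
Qed.

(** The fundamental theorem of calculus on [-m, 0] for a function that is
differentiable in the open interval only. *)
Lemma Rintegral_FTC2_clamp (f f' : R -> R) :
  {within `[- m, 0], continuous f} ->
  (forall p, p \in `]- m, 0[ -> is_derive p 1 f (f' p)) ->
  continuous (f' \o clamp) ->
  \int[mu]_(p in `[- m, 0]) f' (clamp p) = f 0 - f (- m).
Proof.
move=> cf df cf'.
have m0 : - m < 0 by rewrite oppr_lt0.
have [c1 c2 c3] := (continuous_within_itvP f m0).1 cf.
rewrite /Rintegral (continuous_FTC2 m0 (F := f)) //.
- exact: continuous_subspaceT.
- by split => // p pm; have [] := df p pm.
- move=> p pm; rewrite derive1E; have [_ ->] := df p pm.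
  by rewrite /= clamp_id // subset_itv_oo_cc.
Qed.

(** The infimum over the open strip is a lower bound on the closed one.  If the
image were not bounded below, its [inf] would be 0 by convention. *)
Lemma inf_lower_bound (f : R * R -> R) : continuous (fun z => f (z.1, clamp z.2)) ->
  0 < inf (f @` strip m) ->
  forall z, inf (f @` strip m) <= f (z.1, clamp z.2).
Proof.
move=> cf f0 [x p] /=; set c := inf _ in f0 *.
have hl : has_lbound (f @` strip m).
  apply: contrapT => nl; move: f0; rewrite /c inf_out ?ltxx // => -[_ h].
  exact: nl.
have lb q : q \in `]- m, 0[ -> c <= f (x, q).
  by move=> qm; apply: ge_inf => //; exists (x, q).
rewrite leNgt; apply/negP => fc.
have m0 : - m < 0 by rewrite oppr_lt0.
have cS : continuous (fun q => f (x, clamp q)).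
  exact: (continuous_section2 _ x cf).
have pm := clamp_itv p.
(* If the bound failed at p, it would fail in an interval interior to the strip. *)
pose c' := (f (x, clamp p) + c) / 2.
have fc' : f (x, clamp (clamp p)) < c' by rewrite (clamp_id _ pm) /c'; lra.
have [u [v [u1 uv v1 /(_ u)]]] := lt_interval _ _ _ _ c' cS m0 pm fc'.
rewrite in_itv /= lexx (ltW uv) => /(_ isT).
have um : u \in `]- m, 0[ by rewrite in_itv /= u1 (lt_trans uv).
rewrite clamp_id ?subset_itv_oo_cc //.
have := lb u um; rewrite /c'; lra.
Qed.

End Clamp.

(** * The weak equations tested against products *)

Section Identity.
Context {R : realType}.
Implicit Types (a b x p : R) (chi psi : R -> R).
Local Notation mu := (@lebesgue_measure R).

Lemma continuousM_fun (T : topologicalType) (f g : T -> R) :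
  continuous f -> continuous g -> continuous (fun t => f t * g t).
Proof. by move=> cf cg t; apply: cvgM; [exact: cf|exact: cg]. Qed.

Lemma continuousD_fun (T : topologicalType) (f g : T -> R) :
  continuous f -> continuous g -> continuous (fun t => f t + g t).
Proof. by move=> cf cg t; apply: cvgD; [exact: cf|exact: cg]. Qed.

Lemma continuousB_fun (T : topologicalType) (f g : T -> R) :
  continuous f -> continuous g -> continuous (fun t => f t - g t).
Proof. by move=> cf cg x; apply: cvgB; [exact: cf|exact: cg]. Qed.

Lemma continuousV_fun (T : topologicalType) (f : T -> R) :
  (forall t, f t != 0) -> continuous f -> continuous (fun t => (f t)^-1).
Proof. by move=> f0 cf t; apply: cvgV => //; exact: cf. Qed.

Lemma continuousX_fun (T : topologicalType) (f : T -> R) n :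
  continuous f -> continuous (fun t => f t ^+ n).
Proof.
move=> cf; elim: n => [|n IH]; first by move=> t; exact: cvg_cst.
rewrite (_ : (fun t => _) = (fun t => f t * f t ^+ n)).
  exact: continuousM_fun.
by apply/funext => t; rewrite exprS.
Qed.

Lemma continuousN_fun (T : topologicalType) (f : T -> R) :
  continuous f -> continuous (fun t => - f t).
Proof. by move=> cf t; apply: cvgN; exact: cf. Qed.

Lemma continuous_cst_fun (T : topologicalType) (c : R) : continuous (fun _ : T => c).
Proof. by move=> t; exact: cvg_cst. Qed.

Lemma continuousZ_fun (T : topologicalType) (c : R) (f : T -> R) :
  continuous f -> continuous (fun t => c * f t).
Proof. by move=> cf; apply: continuousM_fun => //; exact: continuous_cst_fun. Qed.

Lemma continuous_fst (f : R -> R) : continuous f -> continuous (fun z : R * R => f z.1).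
Proof. by move=> cf z; apply: (@continuous_comp _ _ _ fst f); [exact: cvg_fst|exact: cf]. Qed.

Lemma continuous_snd (f : R -> R) : continuous f -> continuous (fun z : R * R => f z.2).
Proof. by move=> cf z; apply: (@continuous_comp _ _ _ snd f); [exact: cvg_snd|exact: cf]. Qed.

Lemma test_in0 a b chi x : test_in a b chi -> x \notin `]a, b[ ->
  chi x = 0 /\ chi^`()%classic x = 0.
Proof.
move=> [schi [u [v [au uv vb chi0]]]] xab.
have xuv : x < u \/ v < x.
  move: xab; rewrite in_itv /= negb_and -!leNgt => /orP[h|h]; [left|right].
    exact: le_lt_trans au.
  exact: lt_le_trans h.
have nx : \forall y \near x, chi y = 0.
  case: xuv => h; near=> y; apply: chi0; rewrite in_itv /= negb_and -!ltNge.
    by apply/orP; left; near: y; exact: lt_nbhsl.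
  by apply/orP; right; near: y; exact: lt_nbhsr.
split; first exact: (nbhs_singleton nx).
rewrite derive1E.
have [_ ->] // : is_derive x 1 chi 0.
apply: near_eq_is_derive (is_derive_cst (0:R) x (1:R)).
by near=> y; apply/esym; near: y.
Unshelve. all: by end_near. Qed.

Lemma test_in_smooth a b chi : test_in a b chi -> smooth chi.
Proof. by case. Qed.

Lemma test_in_test1 a b chi : test_in a b chi -> test1 setT chi.
Proof.
by move=> [schi [u [v [au uv vb chi0]]]]; exact: (smooth_test1 _ _ u v).
Qed.

Lemma test_in_test2 a b m chi psi : test_in a b chi -> test_in (- m) 0 psi ->
  test2 (strip m) (tprod chi psi).
Proof.
move=> [schi [u [v [au uv vb chi0]]]] [spsi [s [t [ms st t0 psi0]]]].
apply: (tprod_test2 _ _ _ u v s t) => // -[x p] [] /= _.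
rewrite in_itv /= => /andP[sp pt]; split => //=.
by rewrite in_itv /= (lt_le_trans ms) // (le_lt_trans pt).
Qed.

(** The function f agrees with A(q, p) chi(q) psi(p) in the open strip only,
whereas A is continuous on the plane.  The integrand vanishes on the boundary of
[a, b] x [-m, 0], so the closed box may replace the support of chi psi. *)
Lemma strip_integral m a b (f : R * R -> R) (A : R * R -> R) (chi psi : R -> R) :
  continuous A -> continuous chi -> continuous psi ->
  (forall z, strip m z -> f z = A z * (chi z.1 * psi z.2)) ->
  (forall x, x \notin `]a, b[ -> chi x = 0) ->
  (forall p, p \notin `]- m, 0[ -> psi p = 0) ->
  \int[leb2]_(z in strip m) f z =
  \int[mu]_(p in `[- m, 0]) ((\int[mu]_(x in `[a, b]) (A (x, p) * chi x)) * psi p).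
Proof.
move=> cA cchi cpsi fE chi0 psi0.
pose g (z : R * R) := A z * (chi z.1 * psi z.2).
have cg : continuous g.
  apply: continuousM_fun => //; apply: continuousM_fun.
    exact: continuous_fst.
  exact: continuous_snd.
have [|_ ->] := fubini_box f g (strip m) a b (- m) 0 cg.
  move=> [x p]; rewrite !patchE in_box.
  have [xab|xab] := boolP (x \in `]a, b[); last first.
    have g0 : g (x, p) = 0 by rewrite /g /= chi0 // mul0r mulr0.
    transitivity (0 : R); last by case: ifP.
    by case: ifP => // /set_mem zs; rewrite fE //; exact: g0.
  have [pm|pm] := boolP (p \in `]- m, 0[); last first.
    have g0 : g (x, p) = 0 by rewrite /g /= psi0 // mulr0 mulr0.
    transitivity (0 : R); last by case: ifP.
    by case: ifP => // /set_mem zs; rewrite fE //; exact: g0.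
  have -> : x \in `[a, b]%classic by rewrite inE /=; exact: subset_itv_oo_cc xab.
  have -> : p \in `[- m, 0]%classic by rewrite inE /=; exact: subset_itv_oo_cc pm.
  by rewrite mem_set; [rewrite fE|split].
apply: eq_Rintegral => p _; rewrite -RintegralZr //.
  by apply: eq_Rintegral => x _; rewrite /g /= mulrA.
apply: continuous_integrable; apply: continuousM_fun => //.
exact: continuous_section1.
Qed.

Lemma interior_weak m a b hq hp Hp (A B : R * R -> R) chi psi :
  interior_eq m hq hp Hp -> continuous A -> continuous B ->
  (forall z, strip m z -> flux_p hq hp Hp z = A z) ->
  (forall z, strip m z -> flux_q hq hp z = B z) ->
  test_in a b chi -> test_in (- m) 0 psi ->
  \int[mu]_(p in `[- m, 0])
    ((\int[mu]_(x in `[a, b]) (A (x, p) * chi x)) * psi^`()%classic p +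
     (\int[mu]_(x in `[a, b]) (B (x, p) * chi^`()%classic x)) * psi p) = 0.
Proof.
move=> ie cA cB AE BE tchi tpsi.
have schi := test_in_smooth _ _ _ tchi.
have spsi := test_in_smooth _ _ _ tpsi.
have cchi := smooth_continuous _ schi.
have cpsi := smooth_continuous _ spsi.
have cchi' := smooth_continuous _ (smooth_derive1 _ schi).
have cpsi' := smooth_continuous _ (smooth_derive1 _ spsi).
have := ie _ (test_in_test2 _ _ _ _ _ tchi tpsi).
rewrite /dist_partial -opprD => /eqP; rewrite oppr_eq0 => /eqP.
rewrite (strip_integral m a b _ A chi psi^`()%classic) //; first last.
- by move=> p pm; have [] := test_in0 _ _ _ p tpsi pm.
- by move=> p pm; have [] := test_in0 _ _ _ p tchi pm.
- by move=> z zs; rewrite AE // derive_tprod_p.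
rewrite (strip_integral m a b _ B chi^`()%classic psi) //; first last.
- by move=> p pm; have [] := test_in0 _ _ _ p tpsi pm.
- by move=> p pm; have [] := test_in0 _ _ _ p tchi pm.
- by move=> z zs; rewrite BE // derive_tprod_q.
rewrite -RintegralD //; apply: continuous_integrable; apply: continuousM_fun => //.
- apply: (continuous_param2 (fun z => A z * chi z.1)).
  by apply: continuousM_fun => //; exact: continuous_fst.
- apply: (continuous_param2 (fun z => B z * chi^`()%classic z.1)).
  by apply: continuousM_fun => //; exact: continuous_fst.
Qed.

(** The equation A_p + B_q = 0 tested against chi(q) Phi(p).  The function Phi does
not vanish on p = 0, whence the boundary term on the left. *)
Lemma vertical_flux m a b (A B : R * R -> R) (Phi G : R -> R) chi : 0 < m ->
  continuous A -> continuous B -> continuous G ->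
  (forall p, is_derive p 1 Phi (G p)) -> Phi (- m) = 0 ->
  test_in a b chi ->
  (forall psi, test_in (- m) 0 psi ->
    \int[mu]_(p in `[- m, 0])
    ((\int[mu]_(x in `[a, b]) (A (x, p) * chi x)) * psi^`()%classic p +
     (\int[mu]_(x in `[a, b]) (B (x, p) * chi^`()%classic x)) * psi p) = 0) ->
  (\int[mu]_(x in `[a, b]) (A (x, 0) * chi x)) * Phi 0 =
  \int[mu]_(x in `[a, b]) (chi x * (\int[mu]_(p in `[- m, 0]) (A (x, p) * G p)) +
     chi^`()%classic x * (\int[mu]_(p in `[- m, 0]) (B (x, p) * Phi p))).
Proof.
move=> m0 cA cB cG dPhi Phim tchi H.
have schi := test_in_smooth _ _ _ tchi.
have cchi := smooth_continuous _ schi.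
have cchi' := smooth_continuous _ (smooth_derive1 _ schi).
have cPhi := is_derive_continuous _ _ dPhi.
have cAchi : continuous (fun z => A z * chi z.1).
  by apply: continuousM_fun => //; exact: continuous_fst.
have cBchi : continuous (fun z => B z * chi^`()%classic z.1).
  by apply: continuousM_fun => //; exact: continuous_fst.
set Achi := fun p => \int[mu]_(x in `[a, b]) (A (x, p) * chi x).
set Bchi := fun p => \int[mu]_(x in `[a, b]) (B (x, p) * chi^`()%classic x).
have cAc : continuous Achi by exact: (continuous_param2 _ a b cAchi).
have cBc : continuous Bchi by exact: (continuous_param2 _ a b cBchi).
have [W dW] := primitive_exists _ cBc.
have Nm0 : - m < 0 by rewrite oppr_lt0.
(* Achi is differentiable on [-m, 0], with derivative Bchi. *)
have dbr := du_bois_reymond Achi Bchi W (- m) 0 Nm0 cAc cBc dW H.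
have m_in : - m \in `[- m, 0] by rewrite in_itv /= lexx ltW.
have zero_in : 0 \in `[- m, 0] by rewrite in_itv /= lexx ltW.
pose k := Achi 0 - W 0.
have AcE p : p \in `[- m, 0] -> Achi p = W p + k.
  by move=> pm; rewrite /k (dbr 0 p zero_in pm) addrC subrK.
have cW := is_derive_continuous _ _ dW.
have dWPhi p : is_derive p (1:R) (fun p => (W p + k) * Phi p)
    ((W p + k) * G p + Bchi p * Phi p).
  rewrite [Bchi p * _]mulrC; apply: is_deriveM.
  by rewrite -[Bchi p]addr0; apply: is_deriveD.
have cWk : continuous (fun p => W p + k).
  by apply: continuousD_fun => // ?; exact: cvg_cst.
have cWPhi : continuous (fun p => (W p + k) * G p + Bchi p * Phi p).
  by apply: continuousD_fun; apply: continuousM_fun.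
have := Rintegral_FTC2 _ _ _ _ (ltW Nm0) cWPhi dWPhi.
(* The left-hand side is now the integral over [-m, 0] of (Achi Phi)'. *)
rewrite Phim mulr0 subr0 -AcE // => <-.
transitivity (\int[mu]_(p in `[- m, 0]) (Achi p * G p + Bchi p * Phi p)).
  by apply: eq_Rintegral => p /set_mem pm; rewrite AcE.
rewrite RintegralD //; try by apply: continuous_integrable; exact: continuousM_fun.
have cAG : continuous (fun z => A z * chi z.1 * G z.2).
  by apply: continuousM_fun => //; exact: continuous_snd.
have cBP : continuous (fun z => B z * chi^`()%classic z.1 * Phi z.2).
  by apply: continuousM_fun => //; exact: continuous_snd.
have cAG0 : continuous (fun z => A z * G z.2).
  by apply: continuousM_fun => //; exact: continuous_snd.
have cBP0 : continuous (fun z => B z * Phi z.2).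
  by apply: continuousM_fun => //; exact: continuous_snd.
rewrite RintegralD //; last 2 first.
- apply: continuous_integrable; apply: continuousM_fun => //.
  exact: (continuous_param _ (- m) 0 cAG0).
- apply: continuous_integrable; apply: continuousM_fun => //.
  exact: (continuous_param _ (- m) 0 cBP0).
congr (_ + _).
- transitivity (\int[mu]_(p in `[- m, 0]) \int[mu]_(x in `[a, b]) (A (x, p) * chi x * G p)).
    apply: eq_Rintegral => p _; rewrite -RintegralZr //.
    by apply: continuous_integrable; exact: (continuous_section1 _ p cAchi).
  rewrite -(Rintegral_swap (fun z => A z * chi z.1 * G z.2)) //=.
  apply: eq_Rintegral => x _; rewrite -RintegralZl //.
    by apply: eq_Rintegral => p _; ring.
  by apply: continuous_integrable; exact: (continuous_section2 _ x cAG0).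
- transitivity (\int[mu]_(p in `[- m, 0]) \int[mu]_(x in `[a, b]) (B (x, p) * chi^`()%classic x * Phi p)).
    apply: eq_Rintegral => p _; rewrite -RintegralZr //.
    by apply: continuous_integrable; exact: (continuous_section1 _ p cBchi).
  rewrite -(Rintegral_swap (fun z => B z * chi^`()%classic z.1 * Phi z.2)) //=.
  apply: eq_Rintegral => x _; rewrite -RintegralZl //.
    by apply: eq_Rintegral => p _; ring.
  by apply: continuous_integrable; exact: (continuous_section2 _ x cBP0).
Qed.

(** The surface condition tested against a test function on ]a, b[; A0 and kap
stand for flux_p and h_q / (1 + h_q^2)^(1/2) on p = 0. *)
Lemma surface_weak g sigma a b h hq hp H Hp (A0 kap eta chi : R -> R) :
  surface_eq g sigma h hq hp H Hp ->
  continuous A0 -> continuous kap -> continuous eta ->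
  (forall x, (1 + hq (x, 0) ^+ 2) / (2 * hp (x, 0) ^+ 2) - 1 / (2 * Hp 0 ^+ 2) = - A0 x) ->
  (forall x, h (x, 0) - H 0 = eta x) ->
  (forall x, hq (x, 0) / Num.sqrt (1 + hq (x, 0) ^+ 2) = kap x) ->
  test_in a b chi ->
  \int[mu]_(x in `[a, b]) (A0 x * chi x) =
  \int[mu]_(x in `[a, b]) (g * eta x * chi x + sigma * kap x * chi^`()%classic x).
Proof.
move=> se cA ck ce AE eE kE tchi.
have schi := test_in_smooth _ _ _ tchi.
have cchi := smooth_continuous _ schi.
have cchi' := smooth_continuous _ (smooth_derive1 _ schi).
have restr (f f' : R -> R) : (forall x, x \notin `]a, b[ -> f' x = 0) ->
    \int[mu]_(x in setT) (f x * f' x) = \int[mu]_(x in `[a, b]) (f x * f' x).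
  move=> f0; rewrite [RHS]Rintegral_mkcond; apply: eq_Rintegral => x _.
  rewrite patchE; case: ifPn => // xab; rewrite f0 ?mulr0 //.
  by apply: contra xab => xab; rewrite inE /=; exact: subset_itv_oo_cc xab.
have := se _ (test_in_test1 _ _ _ tchi); rewrite /dist_deriv.
rewrite !restr; first last.
- by move=> x xab; have [] := test_in0 _ _ _ x tchi xab.
- by move=> x xab; have [] := test_in0 _ _ _ x tchi xab.
under eq_Rintegral do rewrite AE eE.
under [X in _ * - X]eq_Rintegral do rewrite kE.
have cc c (f : R -> R) : continuous f -> continuous (fun x => c * f x).
  by move=> cf; apply: continuousM_fun => // ?; exact: cvg_cst.
have -> : \int[mu]_(x in `[a, b]) ((- A0 x + g * eta x) * chi x) =
   \int[mu]_(x in `[a, b]) (g * eta x * chi x) - \int[mu]_(x in `[a, b]) (A0 x * chi x).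
  rewrite -RintegralB //.
  - by apply: eq_Rintegral => x _; ring.
  - by apply: continuous_integrable; apply: continuousM_fun => //; exact: cc.
  - by apply: continuous_integrable; exact: continuousM_fun.
rewrite RintegralD //; last 2 first.
- by apply: continuous_integrable; apply: continuousM_fun => //; exact: cc.
- by apply: continuous_integrable; apply: continuousM_fun => //; exact: cc.
have -> : \int[mu]_(x in `[a, b]) (sigma * kap x * chi^`()%classic x) =
  sigma * \int[mu]_(x in `[a, b]) (kap x * chi^`()%classic x).
  rewrite -RintegralZl //; first by apply: eq_Rintegral => x _; ring.
  by apply: continuous_integrable; exact: continuousM_fun.
set u := \int[mu]_(x in _) _; set v := \int[mu]_(x in _) _; set w := \int[mu]_(x in _) _.
lra.
Qed.

End Identity.

(** * Flux balance for a solitary wave *)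

(** The integrand of the excess term, as a function of h_q, h_p and H_p. *)
Definition excess {R : realType} (hqz hpz Hpz : R) : R :=
  (Hpz ^+ 3 * hqz ^+ 2 + (2 * hpz + Hpz) * (hpz - Hpz) ^+ 2) / (2 * hpz ^+ 2).

(** The left-hand side is flux_p times H_p^3. *)
Lemma excess_flux {R : realType} (q p P : R) : 0 < p -> 0 < P ->
  (- ((1 + q ^+ 2) / (2 * p ^+ 2)) + 1 / (2 * P ^+ 2)) * P ^+ 3 =
  p - P - excess q p P.
Proof. by move=> p0 P0; rewrite /excess; field; rewrite !gt_eqF. Qed.

Section Wave.
Context {R : realType}.
Variables (g d m sigma alpha F : R) (h hq hp : R * R -> R) (H Hp : R -> R).
Hypotheses (m_gt0 : 0 < m) (alpha_gt0 : 0 < alpha).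
Hypotheses (h_C1alpha : C1holder_loc_cstrip m alpha h hq hp)
  (H_C1 : C1_itv (- m) 0 H Hp)
  (wave : solitary_wave g d m sigma h hq hp H Hp)
  (froude : is_froude g m Hp F).
Local Notation mu := (@lebesgue_measure R).

(** The continuous extensions to the plane of h_q and h_p, and to the line of
H_p, constant in p outside [-m, 0]. *)
Definition hq_ext (z : R * R) := hq (z.1, clamp m z.2).
Definition hp_ext (z : R * R) := hp (z.1, clamp m z.2).
Definition Hp_ext (p : R) := Hp (clamp m p).

Let continuous_hq_ext : continuous hq_ext.
Proof.
case: h_C1alpha => _ _ _ hh _.
exact: (holder_continuous_clamp _ m_gt0 _ _ alpha_gt0 hh).
Qed.

Let continuous_hp_ext : continuous hp_ext.
Proof.
case: h_C1alpha => _ _ _ _ hh.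
exact: (holder_continuous_clamp _ m_gt0 _ _ alpha_gt0 hh).
Qed.

Let continuous_Hp_ext : continuous Hp_ext.
Proof. by case: H_C1 => _ _ cH; exact: (continuous_comp_clamp _ m_gt0 _ cH). Qed.

Definition inf_hp := inf (hp @` strip m).

Let inf_hp_gt0 : 0 < inf_hp. Proof. exact: sw_inf_hp wave. Qed.

Let inf_hp_le z : inf_hp <= hp_ext z.
Proof. exact: (inf_lower_bound _ m_gt0 hp continuous_hp_ext inf_hp_gt0 z). Qed.

Let hp_ext_gt0 z : 0 < hp_ext z. Proof. exact: lt_le_trans (inf_hp_le z). Qed.

Let Hp_ext_gt0 p : 0 < Hp_ext p.
Proof. by apply: (sw_min_Hp wave); exact: clamp_itv. Qed.

(** The fluxes, the sine of the slope angle of the surface, and the excess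
integrand, all computed from the extended functions. *)
Definition flux_p_ext : R * R -> R := flux_p hq_ext hp_ext Hp_ext.
Definition flux_q_ext : R * R -> R := flux_q hq_ext hp_ext.
Definition surface_sine (x : R) : R :=
  hq_ext (x, 0) / Num.sqrt (1 + hq_ext (x, 0) ^+ 2).
Definition excess_ext (z : R * R) : R := excess (hq_ext z) (hp_ext z) (Hp_ext z.2).

Let continuous_Hp_ext2 : continuous (fun z : R * R => Hp_ext z.2).
Proof. exact: continuous_snd. Qed.

Let continuous_flux_p_ext : continuous flux_p_ext.
Proof.
apply: continuousD_fun.
  apply: continuousN_fun; apply: continuousM_fun.
    by apply: continuousD_fun; [exact: continuous_cst_fun|exact: continuousX_fun].
  apply: continuousV_fun => [z|]; first by rewrite mulf_neq0 // expf_neq0 // gt_eqF.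
  by apply: continuousM_fun; [exact: continuous_cst_fun|exact: continuousX_fun].
apply: continuousM_fun; first exact: continuous_cst_fun.
apply: continuousV_fun => [z|]; first by rewrite mulf_neq0 // expf_neq0 // gt_eqF.
by apply: continuousM_fun; [exact: continuous_cst_fun|exact: continuousX_fun].
Qed.

Let continuous_flux_q_ext : continuous flux_q_ext.
Proof.
by apply: continuousM_fun => //; apply: continuousV_fun => // z; rewrite gt_eqF.
Qed.

Let continuous_surface_sine : continuous surface_sine.
Proof.
have cq0 : continuous (fun x => hq_ext (x, 0)) by exact: continuous_section1.
apply: continuousM_fun => //; apply: continuousV_fun => [x|x].
  by rewrite gt_eqF // sqrtr_gt0 ltr_pwDl // sqr_ge0.
apply: (@continuous_comp _ _ _ (fun x => 1 + hq_ext (x, 0) ^+ 2) Num.sqrt).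
  by apply: continuousD_fun; [exact: continuous_cst_fun|exact: continuousX_fun].
exact: sqrt_continuous.
Qed.

Let continuous_excess_ext : continuous excess_ext.
Proof.
apply: continuousM_fun; last first.
  apply: continuousV_fun => [z|]; first by rewrite mulf_neq0 // expf_neq0 // gt_eqF.
  by apply: continuousM_fun; [exact: continuous_cst_fun|exact: continuousX_fun].
apply: continuousD_fun; apply: continuousM_fun; try exact: continuousX_fun.
  by apply: continuousD_fun => //; apply: continuousM_fun => //; exact: continuous_cst_fun.
by apply: continuousX_fun; exact: continuousB_fun.
Qed.

Let continuous_hpHp : continuous (fun z => hp_ext z - Hp_ext z.2).
Proof. exact: continuousB_fun. Qed.

(** Both h and H vanish on the bed, so the elevation is recovered from their
derivatives in p; in particular it is continuous. *)
Lemma elevation_integral x :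
  elevation h H x = \int[mu]_(p in `[- m, 0]) (hp_ext (x, p) - Hp_ext p).
Proof.
case: h_C1alpha => ch _ dh _ _; case: H_C1 => cH dH _.
rewrite RintegralB //; last 2 first.
- by apply: continuous_integrable; exact: continuous_section2.
- exact: continuous_integrable.
have -> : \int[mu]_(p in `[- m, 0]) Hp_ext p = H 0 - H (- m).
  exact: (Rintegral_FTC2_clamp _ m_gt0 H Hp cH dH continuous_Hp_ext).
have -> : \int[mu]_(p in `[- m, 0]) hp_ext (x, p) = h (x, 0) - h (x, - m).
  apply: (Rintegral_FTC2_clamp _ m_gt0 (fun p => h (x, p)) (fun p => hp (x, p))).
  - exact: within_section.
  - by move=> p pm; apply: is_derive_section; apply: dh; split.
  - exact: (continuous_section2 _ x continuous_hp_ext).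
by rewrite (sw_bed wave) (sw_H_bed wave) !subr0.
Qed.

Let continuous_elevation : continuous (elevation h H).
Proof.
rewrite (_ : elevation h H = fun x => \int[mu]_(p in `[- m, 0]) (hp_ext (x, p) - Hp_ext p)).
  exact: (continuous_param _ (- m) 0 continuous_hpHp).
by apply/funext => x; exact: elevation_integral.
Qed.

Let continuous_Hp_ext3 : continuous (fun p => Hp_ext p ^+ 3).
Proof. exact: continuousX_fun. Qed.

Section Primitive.
Variable Phi : R -> R.
Hypotheses (dPhi : forall p : R, is_derive p (1:R) Phi (Hp_ext p ^+ 3))
  (Phim : Phi (- m) = 0).

Let continuous_Phi : continuous Phi. Proof. exact: is_derive_continuous dPhi. Qed.

(** The quantity transported in the q direction, and its derivative in q. *)
Definition lateral_flux (x : R) : R :=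
  \int[mu]_(p in `[- m, 0]) (flux_q_ext (x, p) * Phi p)
  - sigma * Phi 0 * surface_sine x.

Definition lateral_source (x : R) : R :=
  \int[mu]_(p in `[- m, 0]) (flux_p_ext (x, p) * Hp_ext p ^+ 3) - g * Phi 0 * elevation h H x.

Let continuous_flux_q_Phi : continuous (fun z => flux_q_ext z * Phi z.2).
Proof. by apply: continuousM_fun => //; exact: continuous_snd. Qed.

Let continuous_flux_p_Hp3 : continuous (fun z => flux_p_ext z * Hp_ext z.2 ^+ 3).
Proof. by apply: continuousM_fun => //; exact: (continuous_snd (fun p => Hp_ext p ^+ 3)). Qed.

Let continuous_int_flux_q :
  continuous (fun x => \int[mu]_(p in `[- m, 0]) (flux_q_ext (x, p) * Phi p)).
Proof. exact: (continuous_param _ (- m) 0 continuous_flux_q_Phi). Qed.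

Let continuous_int_flux_p :
  continuous (fun x => \int[mu]_(p in `[- m, 0]) (flux_p_ext (x, p) * Hp_ext p ^+ 3)).
Proof. exact: (continuous_param _ (- m) 0 continuous_flux_p_Hp3). Qed.

Let continuous_lateral_flux : continuous lateral_flux.
Proof. by apply: continuousB_fun => //; exact: continuousZ_fun. Qed.

Let continuous_lateral_source : continuous lateral_source.
Proof. by apply: continuousB_fun => //; exact: continuousZ_fun. Qed.

Let zero_in_itv : 0 \in `[- m, 0].
Proof. by rewrite in_itv /= lexx oppr_le0 ltW. Qed.

(** [lateral_source] is the weak derivative of [lateral_flux]. *)
Lemma weak_identity a b chi : test_in a b chi ->
  \int[mu]_(x in `[a, b]) (lateral_flux x * chi^`()%classic x + lateral_source x * chi x) = 0.
Proof.
move=> tchi.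
have cchi := smooth_continuous _ (test_in_smooth _ _ _ tchi).
have cchi' := smooth_continuous _ (smooth_derive1 _ (test_in_smooth _ _ _ tchi)).
have inside z : strip m z -> clamp m z.2 = z.2.
  by move=> [_ zm]; apply: clamp_id => //; exact: subset_itv_oo_cc zm.
have zE (z : R * R) : (z.1, z.2) = z by case: z.
have vf := vertical_flux m a b flux_p_ext flux_q_ext Phi
  (fun p => Hp_ext p ^+ 3) chi m_gt0 continuous_flux_p_ext
  continuous_flux_q_ext continuous_Hp_ext3 dPhi Phim tchi.
have AE z : strip m z -> flux_p hq hp Hp z = flux_p_ext z.
  by move=> zs; rewrite /flux_p_ext /flux_p /hq_ext /hp_ext /Hp_ext inside // zE.
have BE z : strip m z -> flux_q hq hp z = flux_q_ext z.
  by move=> zs; rewrite /flux_q_ext /flux_q /hq_ext /hp_ext inside // zE.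
have {vf} := vf (fun psi tpsi => interior_weak m a b hq hp Hp flux_p_ext
  flux_q_ext chi psi (sw_interior wave) continuous_flux_p_ext
  continuous_flux_q_ext AE BE tchi tpsi).
have cl0 : clamp m 0 = 0 by exact: clamp_id.
rewrite (surface_weak g sigma a b h hq hp H Hp (fun x => flux_p_ext (x, 0))
   surface_sine (elevation h H) chi (sw_surface wave)) //; last 3 first.
- exact: (continuous_section1 _ 0 continuous_flux_p_ext).
- by move=> x; rewrite /flux_p_ext /flux_p /hq_ext /hp_ext /Hp_ext /= cl0; ring.
- by move=> x; rewrite /surface_sine /hq_ext /= cl0.
rewrite -RintegralZr; last 2 first.
- exact: measurable_itv.
- apply: continuous_integrable; apply: continuousD_fun;
    by apply: continuousM_fun => //; exact: continuousZ_fun.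
move=> E1; apply/eqP; rewrite -[X in _ == X](subrr (\int[mu]_(x in `[a, b])
  (chi x * \int[mu]_(p in `[- m, 0]) (flux_p_ext (x, p) * Hp_ext p ^+ 3) +
         chi^`()%classic x * \int[mu]_(p in `[- m, 0]) (flux_q_ext (x, p) * Phi p)))).
rewrite -{2}E1 -RintegralB //; last 2 first.
- by apply: continuous_integrable; apply: continuousD_fun; exact: continuousM_fun.
- apply: continuous_integrable; apply: continuousM_fun; last exact: continuous_cst_fun.
  by apply: continuousD_fun; apply: continuousM_fun => //; exact: continuousZ_fun.
by apply/eqP/eq_Rintegral => x _; rewrite /lateral_flux /lateral_source; ring.
Qed.

Let Phi_surface_froude : g * Phi 0 = 1 / F ^+ 2.
Proof.
case: froude => _ ->; congr (_ * _).
have m0 : - m <= 0 by rewrite oppr_le0 ltW.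
have := Rintegral_FTC2 _ _ _ _ m0 continuous_Hp_ext3 dPhi; rewrite Phim subr0 => <-.
by apply: eq_Rintegral => p /set_mem pm; rewrite /Hp_ext clamp_id.
Qed.

(** The left-hand side is minus the integral over [-M, M] of [lateral_source]. *)
Lemma flux_balance (M : R) : 0 < M ->
  (1 / F ^+ 2 - 1) * \int[mu]_(x in `[- M, M]) (elevation h H x) +
     \int[mu]_(q in `[- M, M]) \int[mu]_(p in `[- m, 0])
       ((Hp p ^+ 3 * hq (q, p) ^+ 2
         + (2 * hp (q, p) + Hp p) * (hp (q, p) - Hp p) ^+ 2)
        / (2 * hp (q, p) ^+ 2)) = lateral_flux (- M) - lateral_flux M.
Proof.
move=> M0; have NMM : - M < M by rewrite gtrN.
have [W dW] := primitive_exists _ continuous_lateral_source.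
have dbr := du_bois_reymond lateral_flux lateral_source W (- M) M NMM
  continuous_lateral_flux continuous_lateral_source dW (@weak_identity (- M) M).
have {}dbr : lateral_flux M - lateral_flux (- M) =
    \int[mu]_(x in `[- M, M]) lateral_source x.
  rewrite (Rintegral_FTC2 _ _ _ _ (ltW NMM) continuous_lateral_source dW).
  have := dbr M (- M); rewrite !in_itv /= !lexx (ltW NMM) => /(_ isT isT).
  lra.
rewrite -[RHS]opprB dbr.
have DE x : lateral_source x = - 1 * ((1 / F ^+ 2 - 1) * elevation h H x +
    \int[mu]_(p in `[- m, 0]) excess_ext (x, p)).
  have -> : \int[mu]_(p in `[- m, 0]) excess_ext (x, p) =
     elevation h H x - \int[mu]_(p in `[- m, 0]) (flux_p_ext (x, p) * Hp_ext p ^+ 3).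
    rewrite elevation_integral -RintegralB //; last 2 first.
    - by apply: continuous_integrable; exact: (continuous_section2 _ x continuous_hpHp).
    - by apply: continuous_integrable; exact: (continuous_section2 _ x continuous_flux_p_Hp3).
    apply: eq_Rintegral => p _; rewrite /flux_p_ext /= excess_flux //.
    by rewrite /excess_ext /=; ring.
  by rewrite /lateral_source Phi_surface_froude; ring.
have cIP : continuous (fun x => \int[mu]_(p in `[- m, 0]) excess_ext (x, p)).
  exact: (continuous_param _ (- m) 0 continuous_excess_ext).
transitivity ((1 / F ^+ 2 - 1) * \int[mu]_(x in `[- M, M]) elevation h H x +
    \int[mu]_(x in `[- M, M]) \int[mu]_(p in `[- m, 0]) excess_ext (x, p)).
  congr (_ + _); apply: eq_Rintegral => x _; apply: eq_Rintegral => p /set_mem pm.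
  by rewrite /excess_ext /excess /hq_ext /hp_ext /Hp_ext /= clamp_id.
rewrite -(Rintegral_lincomb _ (elevation h H)
  (fun x => \int[mu]_(p in `[- m, 0]) excess_ext (x, p))) //.
rewrite -[RHS]mulN1r -[RHS]RintegralZl //; last exact: continuous_integrable.
apply: eq_Rintegral => x _; rewrite DE; ring.
Qed.

(** The L^1 norm of Phi on [-m, 0]. *)
Definition mass_Phi := \int[mu]_(p in `[- m, 0]) `|Phi p|.

Lemma boundary_flux_le x eps : 0 < eps ->
  (forall p, p \in `[- m, 0] -> `|hq (x, p)| <= eps) ->
  `|lateral_flux x| <= eps * (mass_Phi / inf_hp + `|sigma * Phi 0|).
Proof.
move=> eps0 hx.
have hqx p : `|hq_ext (x, p)| <= eps by apply: hx; exact: clamp_itv.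
rewrite mulrDr (le_trans (ler_normB _ _)) // lerD //.
- apply: le_trans (le_normr_Rintegral _ _) _ => //.
    by apply: continuous_integrable; exact: (continuous_section2 _ x continuous_flux_q_Phi).
  have cnP : continuous (fun p => `|Phi p|).
    by move=> p; apply: cvg_norm; exact: continuous_Phi.
  rewrite mulrCA mulrC -RintegralZl //; last exact: continuous_integrable.
  apply: le_Rintegral => //.
  + apply: continuous_integrable => p; apply: cvg_norm.
    exact: (continuous_section2 _ x continuous_flux_q_Phi).
  + by apply: continuous_integrable; exact: continuousZ_fun.
  + move=> p _; rewrite normrM ler_wpM2r // /flux_q_ext normrM normfV.
    have Vc : (hp_ext (x, p))^-1 <= inf_hp^-1 by rewrite lef_pV2 ?posrE.
    rewrite (gtr0_norm (hp_ext_gt0 _)); apply: ler_pM => //.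
    by rewrite invr_ge0 ltW.
- rewrite normrM mulrC ler_wpM2r // /surface_sine normrM normfV.
  have q1 : 1 <= 1 + hq_ext (x, 0) ^+ 2 by rewrite lerDl sqr_ge0.
  have s1 : 1 <= Num.sqrt (1 + hq_ext (x, 0) ^+ 2).
    by rewrite -[leLHS]sqrtr1 ler_sqrt // (le_trans ler01).
  rewrite (ger0_norm (le_trans ler01 s1)).
  apply: (@le_trans _ _ `|hq_ext (x, 0)|) => //.
  by rewrite ler_piMr // invf_le1 // (lt_le_trans ltr01).
Qed.

Lemma flux_vanishes :
  (fun M : R => lateral_flux (- M) - lateral_flux M) @ +oo --> (0 : R).
Proof.
pose K := mass_Phi / inf_hp + `|sigma * Phi 0|.
have K0 : 0 <= K.
  rewrite addr_ge0 // divr_ge0 //; last exact: ltW.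
  by apply: Rintegral_ge0.
apply/cvgrPdist_le => e e0.
pose eps := e / (2 * (K + 1)).
have eps0 : 0 < eps by rewrite divr_gt0 // mulr_gt0 // ltr_wpDl.
have small x : (forall p, p \in `[- m, 0] -> `|hp (x, p) - Hp p| < eps /\ `|hq (x, p)| < eps) ->
    `|lateral_flux x| <= e / 2.
  move=> hx; apply: le_trans (boundary_flux_le x _ eps0 _) _.
    by move=> p /hx[_ /ltW].
  rewrite -/K /eps.
  rewrite (_ : e / 2 = e / (2 * (K + 1)) * (K + 1)); last first.
    by field; rewrite gt_eqF // ltr_wpDl.
  by rewrite ler_wpM2l ?lerDl // ltW.
have [Mr [_ HMr]] := sw_right wave eps0.
have [Ml [_ HMl]] := sw_left wave eps0.
near=> M; rewrite sub0r normrN (le_trans (ler_normB _ _)) //.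
rewrite [e]splitr lerD //; apply: small.
- apply: HMl; rewrite ltrNl; near: M; apply: nbhs_pinfty_gt; exact: num_real.
- apply: HMr; near: M; apply: nbhs_pinfty_gt; exact: num_real.
Unshelve. all: by end_near. Qed.

End Primitive.

End Wave.

Theorem lemma8p2 (R : realType) (g d m sigma alpha r F : R)
    (h hq hp : R * R -> R) (H Hp : R -> R)
    (g_gt0 : 0 < g) (d_gt0 : 0 < d) (m_gt0 : 0 < m)
    (alpha_gt0 : 0 < alpha) (alpha_lt1 : alpha < 1)
    (r_def : r = 2 / (1 - alpha))
    (eta_W2r : sobolev_loc_line 2 r (elevation h H))
    (h_W2r : sobolev_loc_cstrip m 2 r h)
    (h_C1alpha : C1holder_loc_cstrip m alpha h hq hp)
    (H_W2r : sobolev1 2 r `]- m, 0[ H)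
    (H_C1 : C1_itv (- m) 0 H Hp)
    (wave : solitary_wave g d m sigma h hq hp H Hp)
    (froude : is_froude g m Hp F) :
  (fun M : R =>
     (1 / F ^+ 2 - 1) * \int[lebesgue_measure]_(x in `[- M, M]) (elevation h H x) +
     \int[lebesgue_measure]_(q in `[- M, M]) \int[lebesgue_measure]_(p in `[- m, 0])
       ((Hp p ^+ 3 * hq (q, p) ^+ 2
         + (2 * hp (q, p) + Hp p) * (hp (q, p) - Hp p) ^+ 2)
        / (2 * hp (q, p) ^+ 2)))
  @ +oo --> (0 : R).
Proof.
have cG : continuous (fun p => Hp (clamp m p) ^+ 3).
  apply: continuousX_fun; case: H_C1 => _ _ cH.
  exact: (continuous_comp_clamp _ m_gt0 _ cH).
have [P dP] := primitive_exists _ cG.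
pose Phi p := P p - P (- m).
have Phim : Phi (- m) = 0 by rewrite /Phi subrr.
have dPhi (p : R) : is_derive p (1:R) Phi (Hp (clamp m p) ^+ 3).
  by rewrite -[X in is_derive _ _ _ X]subr0; apply: is_deriveB.
have fb M := flux_balance g d m sigma alpha F h hq hp H Hp m_gt0 alpha_gt0
  h_C1alpha H_C1 wave froude Phi dPhi Phim M.
have := flux_vanishes g d m sigma alpha h hq hp H Hp m_gt0 alpha_gt0 h_C1alpha
  wave Phi dPhi.
apply: cvg_trans; apply: near_eq_cvg; near=> M.
by apply/esym/fb; near: M; apply: nbhs_pinfty_gt; exact: num_real.
Unshelve. all: by end_near. Qed.
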